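(* Let $K$ be an algebraically closed field of characteristic $p>0$, $m\ge 1$, $q=p^m$, and let $G_m$ be the $m$-th Frobenius kernel of $G=\mathrm{GL}(n)$ over $K$. The distribution algebra $Dist_K(G_m)$ is generated by the binomials $\binom{H_i}{a}$ for $i=1,\ldots,n$, $0\le a<q$, and the divided powers $x_\alpha^{(k)}$ for $\alpha\in\Phi$, $0\le k<q$. The relations among these generators are generated by the following relations (for all $1\le i,j\le n$, $0\le a,b,k,l<q$, $\alpha,\beta\in\Phi$, $0\le u,v<m$): $(a_{i,a,b})$: $\binom{H_i}{a}\binom{H_i}{b}=\sum_{c=0}^{\min\{a,b\}}\binom{a+b-c}{a-c}\binom{b}{b-c}\binom{H_i}{a+b-c}$; $(b_{\alpha,k,l})$: $x_\alpha^{(k)}x_\alpha^{(l)}=\binom{k+l}{k}x_\alpha^{(k+l)}$, $x_\alpha^{(0)}=1$; $(c_{i,j,p^u,p^v})$: $\binom{H_i}{p^u}\binom{H_j}{p^v}=\binom{H_j}{p^v}\binom{H_i}{p^u}$; $(d_{\alpha,\beta,p^u,p^v})$: $x_\alpha^{(p^u)}x_\beta^{(p^v)}=\sum_{a=0}^{\min\{p^u,p^v\}}c_{\alpha,\beta}^a\,x_\beta^{(p^v-a)}x_{\alpha+\beta}^{(a)}x_\alpha^{(p^u-a)}$ if $\alpha+\beta\in\Phi$; $(e_{\alpha,p^u,p^v})$: $x_\alpha^{(p^u)}x_{-\alpha}^{(p^v)}=\sum_{a=0}^{\min\{p^u,p^v\}}x_{-\alpha}^{(p^v-a)}\binom{H_\alpha-p^u-p^v+2a}{a}x_\alpha^{(p^u-a)}$;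 $(f_{\alpha,\beta,p^u,p^v})$: $x_\alpha^{(p^u)}x_\beta^{(p^v)}=x_\beta^{(p^v)}x_\alpha^{(p^u)}$ if $\alpha+\beta\ne0$ and $\alpha+\beta\notin\Phi$; $(g_{\alpha,p^u,p^v})$: for $\alpha=\epsilon_i-\epsilon_j$: $\binom{H_i}{p^v}x_\alpha^{(p^u)}=x_\alpha^{(p^u)}\binom{H_i+p^u}{p^v}$ with the sign convention of the context, namely the printed relations are $\binom{H_i}{a}x_\alpha^{(k)}=x_\alpha^{(k)}\binom{H_i+k}{a}$, $\binom{H_j}{a}x_\alpha^{(k)}=x_\alpha^{(k)}\binom{H_j-k}{a}$, and $\binom{H_l}{a}x_\alpha^{(k)}=x_\alpha^{(k)}\binom{H_l}{a}$ for $l\ne i,j$, with $k=p^u$, $a=p^v$; $(h_{\alpha,p^u,p^v})$: for $\alpha=\epsilon_i-\epsilon_j$, $k=p^u$, $a=p^v$: $x_\alpha^{(k)}\binom{H_i}{a}=\binom{H_i-k}{a}x_\alpha^{(k)}$ and $x_\alpha^{(k)}\binom{H_j}{a}=\binom{H_j+k}{a}x_\alpha^{(k)}$.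
   Context: $\Phi=\{\epsilon_i-\epsilon_j\mid 1\le i\ne j\le n\}$ is the root system. For $\alpha=\epsilon_i-\epsilon_j$, $x_\alpha$ is the matrix unit $e_{ij}$, $x_\alpha^{(k)}=x_\alpha^k/k!$ its divided powers, $H_i=e_{ii}$, and $H_\alpha=H_i-H_j$. When $\alpha=\epsilon_i-\epsilon_j$, $\beta=\epsilon_k-\epsilon_l$ and $\alpha+\beta\in\Phi$, put $c_{\alpha,\beta}=1$ if $j=k$, $i\ne l$, and $c_{\alpha,\beta}=-1$ if $i=l$, $j\ne k$. $Dist(G)=K\otimes_{\mathbb Z}U_{\mathbb Z}$, where $U_{\mathbb Z}\subset U(\mathfrak{gl}_n(\mathbb{Q}))$ is the Kostant $\mathbb{Z}$-form generated by all $\binom{H_i}{k}$ and $x_\alpha^{(k)}$, and $Dist_K(G_m)$ is the subalgebra generated by the $\binom{H_i}{k}$, $x_\alpha^{(k)}$ with $0\le k<q$ (images under $1\otimes -$ are denoted by the same symbols). Conventions: $\binom{H_i}{0}=1$; expressions such as $\binom{H_i\pm k}{a}$ and $\binom{H_\alpha+c}{a}$ with $0\le a<q$ are expanded as integral linear combinations of (products of) $\binom{H_i}{b}$, $\binom{H_j}{b}$ with $0\le b<q$, e.g. $\binom{H_i+ k}{a}=\sum_{t=0}^{a}\binom{H_i}{t}\binom{k}{a-t}$ for any integer $k$, where $\binom{k}{b}=(-1)^b\binom{-k+b-1}{b}$ for $k<0$. In relations (a) and (b), terms $\binom{H_i}{c}$ or $x_\alpha^{(c)}$ with $c\ge q$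 occur with coefficient zero in $K$ and are omitted. *)

(* Defs.v *)
From HB Require Import structures.
From mathcomp Require Import all_boot all_order all_algebra.
From mathcomp Require Import boolp.
From mathcomp Require Import finmap monalg.

Set Implicit Arguments.
Unset Strict Implicit.
Unset Printing Implicit Defensive.

Import GRing.Theory.
Local Open Scope ring_scope.

Inductive subring_gen (A : nzRingType) (S : A -> Prop) : A -> Prop :=
| subring_gen_in x : S x -> subring_gen S x
| subring_gen_1 : subring_gen S 1
| subring_gen_B x y :
    subring_gen S x -> subring_gen S y -> subring_gen S (x - y)
| subring_gen_M x y :
    subring_gen S x -> subring_gen S y -> subring_gen S (x * y).

Inductive subalg_gen (R : comNzRingType) (A : algType R) (S : A -> Prop) :
    A -> Prop :=
| subalg_gen_in x : S x -> subalg_gen S x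
| subalg_gen_1 : subalg_gen S 1
| subalg_gen_Z c x : subalg_gen S x -> subalg_gen S (c *: x)
| subalg_gen_D x y :
    subalg_gen S x -> subalg_gen S y -> subalg_gen S (x + y)
| subalg_gen_M x y :
    subalg_gen S x -> subalg_gen S y -> subalg_gen S (x * y).

(* two-sided ideal *)
Inductive ideal_gen (A : nzRingType) (S : A -> Prop) : A -> Prop :=
| ideal_gen_in x : S x -> ideal_gen S x
| ideal_gen_0 : ideal_gen S 0
| ideal_gen_D x y : ideal_gen S x -> ideal_gen S y -> ideal_gen S (x + y)
| ideal_gen_Ml a x : ideal_gen S x -> ideal_gen S (a * x)
| ideal_gen_Mr a x : ideal_gen S x -> ideal_gen S (x * a).

(* (i, j) stands for epsilon_i - epsilon_j *)
Definition Phi (n : nat) : Type := {ij : 'I_n * 'I_n | ij.1 != ij.2}.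

Section Roots.
Context (n : nat).
Implicit Types a b c : Phi n.

Definition src a : 'I_n := (val a).1.
Definition tgt a : 'I_n := (val a).2.

Fact ropp_subproof a : tgt a != src a.
Proof. by rewrite eq_sym; exact: (valP a). Qed.
Definition ropp a : Phi n := Sub (tgt a, src a) (ropp_subproof a).

Definition rvec a : 'rV[int]_n := delta_mx 0 (src a) - delta_mx 0 (tgt a).

(* The constant c_{a,b}; only meaningful when a + b is a root, in which case
   exactly one of tgt a = src b, src a = tgt b holds. *)
Definition cst a b : int := if tgt a == src b then 1 else -1.
End Roots.

Definition lie_morphism (n : nat) (A : algType rat) (f : 'M[rat]_n -> A) : Prop :=
  forall x y, f (x *m y - y *m x) = f x * f y - f y * f x.

(* (U, iota) is the universal enveloping algebra of gl_n(Q). *)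
Definition is_enveloping (n : nat) (U : algType rat)
    (iota : {linear 'M[rat]_n -> U}) : Prop :=
  lie_morphism iota /\
  forall (A : algType rat) (f : {linear 'M[rat]_n -> A}), lie_morphism f ->
    exists F : {lrmorphism U -> A}, F \o iota =1 f /\
      forall F' : {lrmorphism U -> A}, F' \o iota =1 f -> F' =1 F.

Section KostantForm.
Context (n : nat) (U : algType rat) (iota : {linear 'M[rat]_n -> U}).

Definition Hbin (i : 'I_n) (k : nat) : U :=
  (k`!%:R : rat)^-1 *: \prod_(t < k) (iota (delta_mx i i) - t%:R).

Definition Xdiv (a : Phi n) (k : nat) : U :=
  (k`!%:R : rat)^-1 *: iota (delta_mx (src a) (tgt a)) ^+ k.

Variant kostant_gen : U -> Prop :=
| kostant_gen_H i k : kostant_gen (Hbin i k)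
| kostant_gen_X a k : kostant_gen (Xdiv a k).

Definition kostant : {pred U} := [pred u | `[< subring_gen kostant_gen u >]].

Fact kostant_subring : subring_closed kostant.
Proof.
split=> [|x y /asboolP Sx /asboolP Sy|x y /asboolP Sx /asboolP Sy].
- exact/asboolP/subring_gen_1.
- exact/asboolP/subring_gen_B.
- exact/asboolP/subring_gen_M.
Qed.
HB.instance Definition _ := GRing.isSubringClosed.Build U kostant kostant_subring.

Record UZ : predArgType := MkUZ { UZval : U; UZvalP : UZval \in kostant }.
HB.instance Definition _ := [isSub for UZval].
HB.instance Definition _ := [Choice of UZ by <:].
HB.instance Definition _ := [SubChoice_isSubNzRing of UZ by <:].

Fact HZ_subproof i k : Hbin i k \in kostant.
Proof. exact/asboolP/subring_gen_in/kostant_gen_H. Qed.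
Definition HZ i k : UZ := MkUZ (HZ_subproof i k).

Fact XZ_subproof a k : Xdiv a k \in kostant.
Proof. exact/asboolP/subring_gen_in/kostant_gen_X. Qed.
Definition XZ a k : UZ := MkUZ (XZ_subproof a k).
End KostantForm.

Definition biadditive (M N P : zmodType) (f : M -> N -> P) : Prop :=
  (forall x x' y, f (x + x') y = f x y + f x' y) /\
  (forall x y y', f x (y + y') = f x y + f x y').

(* The K-algebra D is the tensor product of K and the ring R over the integers,
   theta r being the tensor 1 (x) r, hence c *: theta r the tensor c (x) r. *)
Definition is_base_change (K : fieldType) (R : nzRingType) (D : algType K)
    (theta : {rmorphism R -> D}) : Prop :=
  forall (M : zmodType) (f : K -> R -> M), biadditive f ->
    exists g : {additive D -> M}, (forall c r, g (c *: theta r) = f c r) /\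
      forall g' : {additive D -> M},
        (forall c r, g' (c *: theta r) = f c r) -> g' =1 g.

Section FrobeniusKernel.
Context (n : nat) (U : algType rat) (iota : {linear 'M[rat]_n -> U}).
Context (K : fieldType) (D : algType K) (theta : {rmorphism UZ iota -> D}).
Context (q : nat).

Variant dist_gen : D -> Prop :=
| dist_gen_H i (k : 'I_q) : dist_gen (theta (HZ iota i k))
| dist_gen_X a (k : 'I_q) : dist_gen (theta (XZ iota a k)).

Definition Dist : D -> Prop := subalg_gen dist_gen.
End FrobeniusKernel.

(* Formal generators: (i, a) for the binomial H_i choose a and (alpha, k) for
   the divided power x_alpha^(k). *)
Definition gen (n q : nat) : choiceType := (('I_n * 'I_q) + (Phi n * 'I_q))%type.

Definition freeAlg (n q : nat) (K : fieldType) := {malg K[{fmonom gen n q}]}.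

Section Presentation.
Context (n : nat) (U : algType rat) (iota : {linear 'M[rat]_n -> U}).
Context (K : fieldType) (D : algType K) (theta : {rmorphism UZ iota -> D}).
Context (q : nat).

Definition gen_val (g : gen n q) : D :=
  match g with
  | inl (i, k) => theta (HZ iota i k)
  | inr (a, k) => theta (XZ iota a k)
  end.

(* the K-algebra morphism from the free algebra extending gen_val *)
Definition pres (f : {malg K[{fmonom gen n q}]}) : D :=
  \sum_(w <- msupp f) f@_w *: \prod_(g <- (w : seq (gen n q))) gen_val g.
End Presentation.

(* binomial coefficient with integer upper entry: since - k + b - 1 = n + b for
   k = - n.+1, the second case is (-1)^b 'C(- k + b - 1, b) *)
Definition binz (k : int) (b : nat) : int :=
  match k with
  | Posz n => ('C(n, b))%:Z
  | Negz n => (-1) ^+ b * ('C(n + b, b))%:Z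
  end.

Section Relations.
Context (n : nat) (K : fieldType) (p m : nat).
Local Notation q := (p ^ m)%N.
Local Notation F := {malg K[{fmonom gen n q}]}.

Definition var (g : gen n q) : F := << fmu g >>.

(* An index >= q is read as 0: it only arises in rel_a and rel_b, where the
   coefficient in front of it vanishes in characteristic p. *)
Definition hsym (i : 'I_n) (a : nat) : F :=
  if insub a is Some a' then var (inl (i, a')) else 0.
Definition xsym (al : Phi n) (k : nat) : F :=
  if insub k is Some k' then var (inr (al, k')) else 0.

(* H_i + k choose a *)
Definition hshift (i : 'I_n) (k : int) (a : nat) : F :=
  \sum_(t < a.+1) (binz k (a - t))%:~R *: hsym i t.

(* - H_j choose b, which is (-1)^b times H_j + b - 1 choose b *)
Definition hneg (j : 'I_n) (b : nat) : F :=
  (-1) ^+ b *: hshift j (b%:Z - 1) b.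

(* H_i - H_j + c choose a, for al = epsilon_i - epsilon_j; Vandermonde
   convolution of the summands H_i, - H_j and c *)
Definition hroot (al : Phi n) (c : int) (a : nat) : F :=
  \sum_(t < a.+1) \sum_(s < (a - t).+1)
    (binz c (a - t - s))%:~R *: (hsym (src al) t * hneg (tgt al) s).

Inductive defrel : F -> F -> Prop :=
| rel_h0 i : defrel (hsym i 0) 1
| rel_a i a b : (a < q)%N -> (b < q)%N ->
    defrel (hsym i a * hsym i b)
      (\sum_(c < (minn a b).+1)
         ('C(a + b - c, a - c) * 'C(b, b - c))%:R *: hsym i (a + b - c))
| rel_b al k l : (k < q)%N -> (l < q)%N ->
    defrel (xsym al k * xsym al l) ('C(k + l, k)%:R *: xsym al (k + l))
| rel_b0 al : defrel (xsym al 0) 1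
| rel_c i j u v : (u < m)%N -> (v < m)%N ->
    defrel (hsym i (p ^ u) * hsym j (p ^ v)) (hsym j (p ^ v) * hsym i (p ^ u))
| rel_d al be ga u v : (u < m)%N -> (v < m)%N -> rvec al + rvec be = rvec ga ->
    defrel (xsym al (p ^ u) * xsym be (p ^ v))
      (\sum_(a < (minn (p ^ u) (p ^ v)).+1)
         (cst al be ^+ a)%:~R *:
           (xsym be (p ^ v - a) * xsym ga a * xsym al (p ^ u - a)))
| rel_e al u v : (u < m)%N -> (v < m)%N ->
    defrel (xsym al (p ^ u) * xsym (ropp al) (p ^ v))
      (\sum_(a < (minn (p ^ u) (p ^ v)).+1)
         xsym (ropp al) (p ^ v - a)
         * hroot al (- (p ^ u)%N%:Z - (p ^ v)%N%:Z + (2 * a)%N%:Z) a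
         * xsym al (p ^ u - a))
| rel_f al be u v : (u < m)%N -> (v < m)%N ->
    rvec al + rvec be <> 0 -> (forall ga, rvec al + rvec be <> rvec ga) ->
    defrel (xsym al (p ^ u) * xsym be (p ^ v)) (xsym be (p ^ v) * xsym al (p ^ u))
| rel_g_src al u v : (u < m)%N -> (v < m)%N ->
    defrel (hsym (src al) (p ^ v) * xsym al (p ^ u))
      (xsym al (p ^ u) * hshift (src al) (p ^ u)%N%:Z (p ^ v))
| rel_g_tgt al u v : (u < m)%N -> (v < m)%N ->
    defrel (hsym (tgt al) (p ^ v) * xsym al (p ^ u))
      (xsym al (p ^ u) * hshift (tgt al) (- (p ^ u)%N%:Z) (p ^ v))
| rel_g_other al l u v : (u < m)%N -> (v < m)%N ->
    l != src al -> l != tgt al ->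
    defrel (hsym l (p ^ v) * xsym al (p ^ u)) (xsym al (p ^ u) * hsym l (p ^ v))
| rel_h_src al u v : (u < m)%N -> (v < m)%N ->
    defrel (xsym al (p ^ u) * hsym (src al) (p ^ v))
      (hshift (src al) (- (p ^ u)%N%:Z) (p ^ v) * xsym al (p ^ u))
| rel_h_tgt al u v : (u < m)%N -> (v < m)%N ->
    defrel (xsym al (p ^ u) * hsym (tgt al) (p ^ v))
      (hshift (tgt al) (p ^ u)%N%:Z (p ^ v) * xsym al (p ^ u)).

Definition relator (f : F) : Prop := exists l r, defrel l r /\ f = l - r.
End Relations.

(* Main.v *)
From HB Require Import structures.
Require Import Defs.
From mathcomp Require Import all_boot all_order all_algebra.
From mathcomp Require Import finmap monalg zify ring.
From mathcomp Require boolp mpoly.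

Set Implicit Arguments.
Unset Strict Implicit.
Unset Printing Implicit Defensive.

(** That the relations hold is a matter of identities between divided powers
and binomials in the rational enveloping algebra: the commutation rules of a
Heisenberg triple and of an sl2-triple ([dpow_heisenberg], [dpow_kostant]), the
weight of a root vector, and the two product rules. Both sides of a relation
are images of elements of the Kostant form, and the symbols of index at least q
are harmless because their coefficients are divisible by p ([defrel_sound]).

That nothing else holds follows from two estimates which meet at the ordered
monomials prod_(i,j) y_ij^(a_ij), 0 <= a_ij < q, where y_ij^(k) is the divided
power of the root vector e_ij if i <> j and the binomial of H_i if i = j.

They span the presented algebra ([malg_span]). Give y_ij^(k) the degree k. By
the relations, two generators whose indices are powers of p commute modulo
lower degree. Modulo lower degree again, a generator of arbitrary index k = a +
p^u, with p^u the leading base p power of k, is a nonzero multiple of the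
product of those of indices a and p^u, so all generators commute modulo lower
degree. Hence every word can be sorted and its repeated generators merged, at
the cost of words of lower degree.

Their images in Dist are linearly independent ([ykost_free]). Let gl_n act on
the polynomial functions of an n x n matrix X by the vector fields X |-> X Z.
In the coordinates y = X - 1 centred at the identity, divided powers of the
field of e_ij, and binomials in that of e_ii, preserve the polynomials with
integer coefficients ([integral_P]) and agree to leading order with divided
powers of the partial derivative along y_ij ([vanish_PQ]). So the functional
that applies u to the monomial y^B and evaluates at the identity is integral on
the Kostant form, and takes the value delta_AB on the ordered monomial of
exponent A as soon as |A| <= |B| ([coeff_form_mono]). Being integral it extends
to the base change, where this triangularity gives independence in every
characteristic.

Now an element of the free algebra is congruent to a combination of ordered
monomials modulo the ideal of the relations; if it maps to 0, then by
independence the coefficients are 0, and the element lies in the ideal. *)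

Import GRing.Theory.
Local Open Scope ring_scope.

(** * Divided powers and binomials in a rational algebra *)

Section DividedPowers.
Context (A : algType rat).
Implicit Types (u v x y h w : A) (k l a b : nat).

Definition dpow x k : A := (k`!%:R : rat)^-1 *: x ^+ k.

Definition hbin h k : A :=
  (k`!%:R : rat)^-1 *: \prod_(t < k) (h - t%:R).

(** Recursions for divided powers and binomials are stated after multiplication
by the index, which leaves no denominators; this lemma cancels it at the end. *)
Lemma mulrSn_inj k u v : u *+ k.+1 = v *+ k.+1 -> u = v.
Proof.
move=> /(congr1 (fun z => (k.+1%:R : rat)^-1 *: z)).
by rewrite -!scaler_nat !scalerA mulVf ?Num.Theory.pnatr_eq0 // !scale1r.
Qed.

Lemma dpow0 x : dpow x 0 = 1.
Proof. by rewrite /dpow fact0 invr1 scale1r expr0. Qed.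

Lemma dpow1 x : dpow x 1 = x.
Proof. by rewrite /dpow invr1 scale1r expr1. Qed.

Lemma hbin0 h : hbin h 0 = 1.
Proof. by rewrite /hbin fact0 invr1 scale1r big_ord0. Qed.

Lemma invfactS k (z : A) :
  ((k.+1`!%:R : rat)^-1 *: z) *+ k.+1 = (k`!%:R : rat)^-1 *: z.
Proof.
rewrite -scaler_nat scalerA factS natrM invfM mulrA.
by rewrite mulfV ?Num.Theory.pnatr_eq0 // mul1r.
Qed.

Lemma dpowS x k : dpow x k.+1 *+ k.+1 = x * dpow x k.
Proof. by rewrite invfactS exprS scalerAr. Qed.

Lemma dpowSr x k : dpow x k.+1 *+ k.+1 = dpow x k * x.
Proof. by rewrite invfactS exprSr scalerAl. Qed.

Lemma hbinS h k : hbin h k.+1 *+ k.+1 = hbin h k * (h - k%:R).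
Proof. by rewrite invfactS big_ord_recr scalerAl. Qed.

Lemma hbinSl h k : hbin h k.+1 *+ k.+1 = h * hbin (h - 1) k.
Proof.
rewrite invfactS big_ord_recl subr0 scalerAr; congr (_ * (_ *: _)).
by apply: eq_bigr => i _; rewrite -addrA -opprD nat1r.
Qed.

Lemma hbin_intertwine h h' y a :
  h * y = y * h' -> hbin h a * y = y * hbin h' a.
Proof.
move=> hy; rewrite /hbin -scalerAl -scalerAr; congr (_ *: _).
elim: a => [|a IH]; first by rewrite !big_ord0 mul1r mulr1.
rewrite !big_ord_recr /= -mulrA mulrBl hy mulr_natl -mulr_natr -mulrBr.
by rewrite mulrA IH mulrA.
Qed.

Lemma hbin_comm u v a : GRing.comm u v -> GRing.comm (hbin u a) v.
Proof. exact: hbin_intertwine. Qed.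

Lemma hbin_pascal z k : hbin (z - 1) k.+1 + hbin (z - 1) k = hbin z k.+1.
Proof.
apply: (@mulrSn_inj k); rewrite mulrnDl [RHS]hbinSl hbinS.
rewrite -[X in _ + X]mulr_natr -mulrDr -[z - 1 - _]addrA -opprD nat1r subrK.
by apply/hbin_comm/commr_sym/commrB => //; apply: commr1.
Qed.

(** The reindexing common to the inductions on the order of a divided power
below: multiplication by one more factor splits the term i into a contribution
S i to the term i + 1 of the next sum and a contribution T i to its term i. *)
Lemma sum_shiftD (V : zmodType) (S T R : nat -> V) N :
  R 0 = T 0 -> R N.+1 = S N ->
  (forall i, (i < N)%N -> R i.+1 = S i + T i.+1) ->
  \sum_(i < N.+1) (S i + T i) = \sum_(i < N.+2) R i.
Proof.
move=> R0 RN Ri;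
  rewrite big_split /= big_ord_recr [in X in _ + X]big_ord_recl /=.
rewrite [RHS]big_ord_recl big_ord_recr /= R0 RN.
under [in RHS]eq_bigr => i _ do rewrite /bump /= add1n Ri //.
by rewrite big_split /= addrCA addrAC.
Qed.

(** The Vandermonde convolution. *)
Lemma hbinD u v a : GRing.comm u v ->
  hbin (u + v) a = \sum_(t < a.+1) hbin u t * hbin v (a - t).
Proof.
move=> uv; elim: a => [|a IH]; first by rewrite big_ord1 !hbin0 mulr1.
apply: (@mulrSn_inj a); rewrite hbinS IH mulr_suml -sumrMnl.
rewrite -(@sum_shiftD _ (fun i => hbin u i.+1 * hbin v (a - i) *+ i.+1)
            (fun i => hbin u i * hbin v (a - i).+1 *+ (a - i).+1)
            (fun i => hbin u i * hbin v (a.+1 - i) *+ a.+1)).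
- apply: eq_bigr => -[i /=]; rewrite ltnS => lei _;
    rewrite -mulrnAl hbinS -mulrnAr hbinS.
  have cvi : GRing.comm (hbin v (a - i)) (u - i%:R).
    apply/hbin_comm/commrB; last exact: commr_nat.
    exact: commr_sym.
  rewrite -!mulrA -cvi -!mulrDr; congr (_ * (_ * _)).
  by rewrite -{1}(subnKC lei) natrD opprD addrACA.
- by rewrite !subn0.
- by rewrite !subnn.
move=> i lei; rewrite subSS subnSK // -mulrnDr.
by rewrite addSn subnKC // ltnW.
Qed.

Lemma dpow_comm x y k : GRing.comm x y -> GRing.comm (dpow x k) y.
Proof.
move=> xy; apply: commr_sym; rewrite /dpow /GRing.comm -scalerAl -scalerAr.
by congr (_ *: _); apply/commrX/commr_sym.
Qed.

Lemma dpowZ (c : int) x k : dpow (c%:~R * x) k = (c ^+ k)%:~R * dpow x k.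
Proof.
rewrite /dpow -scalerAr rmorphXn /= exprMn_comm //; exact/commr_sym/commr_int.
Qed.

Lemma dpowM x k l : dpow x k * dpow x l = dpow x (k + l) *+ 'C(k + l, k).
Proof.
rewrite /dpow -scalerAl -scalerAr -exprD scalerA -scaler_nat scalerA.
congr (_ *: _); rewrite -(@bin_fact (k + l) k) ?leq_addr // addKn !natrM.
have nz i : (i`!%:R : rat) != 0 by rewrite Num.Theory.pnatr_eq0 -lt0n fact_gt0.
have : ('C(k + l, k)%:R : rat) != 0.
  by rewrite Num.Theory.pnatr_eq0 -lt0n bin_gt0 leq_addr.
by move=> C0; rewrite !invfM mulVKf // mulrC.
Qed.

Lemma hbin_split h b j :
  hbin h b * hbin (h - b%:R) j = hbin h (b + j) *+ 'C(b + j, b).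
Proof.
elim: j => [|j IH]; first by rewrite hbin0 mulr1 addn0 binn.
apply: (@mulrSn_inj j); rewrite -mulrnAr hbinS mulrA IH mulrnAl.
rewrite -addrA -opprD -natrD -hbinS addnS -!mulrnA; congr (_ *+ _).
have := mul_bin_down (b + j).+1 b; rewrite /= subSn ?leq_addr // addKn.
by rewrite mulnC => ->; rewrite mulnC.
Qed.

Lemma binzS (z : int) b : binz z b.+1 *+ b.+1 = binz z b * (z - b%:Z).
Proof.
case: z => n /=; last first.
  rewrite NegzE -opprD -PoszD exprS mulN1r mulNr mulNrn mulrN; congr (- _).
  rewrite -mulrA -mulrnAr; congr (_ * _); rewrite -mulr_natr natz -!PoszM.
  by congr Posz; have := mul_bin_diag (n + b).+1 b; rewrite /= addnS; lia.
rewrite -mulr_natr natz -PoszM mulnC mul_bin_left.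
have [le_bn|lt_nb] := leqP b n; first by rewrite mulnC PoszM subzn.
by rewrite bin_small // muln0 mul0r.
Qed.

Lemma hbin_int (z : int) b : hbin z%:~R b = (binz z b)%:~R.
Proof.
elim: b => [|b IH]; first by rewrite hbin0; case: z => n /=; rewrite ?bin0.
apply: (@mulrSn_inj b); rewrite hbinS IH -[b%:R]/((b%:Z)%:~R) -intrB -intrM.
by rewrite -binzS rmorphMn.
Qed.

Lemma hbin_nat (n : nat) b : hbin n%:R b = 'C(n, b)%:R.
Proof. exact: (hbin_int n b). Qed.

Lemma sum_minn (V : zmodType) (f : nat -> V) k l :
  (forall a, (l < a)%N -> f a = 0) ->
  \sum_(a < k.+1) f a = \sum_(a < (minn k l).+1) f a.
Proof.
move=> f0; rewrite -!(big_mkord xpredT f).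
have le_min : ((minn k l).+1 <= k.+1)%N by rewrite ltnS geq_minl.
rewrite (@big_cat_nat _ _ _ (minn k l).+1) //= [X in _ + X]big_nat.
rewrite [X in _ + X]big1 ?addr0 // => a /andP[]; rewrite gtn_min ltnS.
by move=> /orP[] lt_a le_ak; [rewrite leqNgt lt_a in le_ak|apply: f0].
Qed.

(** Expand the first factor around h - b by the Vandermonde convolution, then
let the second factor absorb the binomials of h - b. *)
Lemma hbinM h a b : hbin h a * hbin h b =
  \sum_(c < (minn a b).+1)
     hbin h (a + b - c) *+ ('C(a + b - c, a - c) * 'C(b, b - c)).
Proof.
pose F c := hbin h (a + b - c) *+ ('C(a + b - c, a - c) * 'C(b, c)).
transitivity (\sum_(c < a.+1) F c).
  rewrite -{1}[h](subrK b%:R) hbinD; last exact: commr_nat.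
  rewrite (reindex_inj rev_ord_inj) mulr_suml; apply: eq_bigr => -[c /=].
  rewrite ltnS subSS => le_ca _; rewrite subKn // hbin_nat /F.
  have hb : GRing.comm (hbin (h - b%:R) (a - c)) (hbin h b).
    apply/hbin_comm/commr_sym/hbin_comm/commrB => //; exact: commr_nat.
  rewrite mulr_natr mulrnAl hb hbin_split -mulrnA.
  rewrite addnC -addnBAC //; congr (_ *+ (_ * _)).
  by rewrite -[in RHS](@bin_sub _ (a - c)) ?leq_addr // addKn.
rewrite (@sum_minn _ F a b) => [|c lt_bc]; last first.
  by rewrite /F (bin_small lt_bc) muln0.
apply: eq_bigr => -[c /=]; rewrite ltnS leq_min => /andP[_ le_cb] _.
by rewrite bin_sub.
Qed.

Lemma hbin_shift h (z : int) a :
  hbin (h + z%:~R) a = \sum_(t < a.+1) (binz z (a - t))%:~R * hbin h t.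
Proof.
rewrite hbinD; last exact: commr_int.
apply: eq_bigr => t _; rewrite hbin_int; exact: commr_int.
Qed.

Lemma hbinN h b : hbin (- h) b = (-1) ^+ b * hbin (h + (b%:Z - 1)%:~R) b.
Proof.
elim: b => [|b IH]; first by rewrite !hbin0 mulr1.
apply: (@mulrSn_inj b); rewrite hbinS IH -mulrnAr hbinSl exprS.
rewrite (_ : (b.+1%:Z - 1) = b%:Z); last lia.
rewrite intrB addrA mulN1r mulNr -opprD mulrN -mulrA; congr (- (_ * _)).
by apply/hbin_comm/commr_sym/commrD => //; apply/commrN/commr1.
Qed.

(** To be used for Y_a = y^(l - a), and Y_a = 0 for a > l, with w = [x, y]
central. Only the commutators of x with the Y_a enter, so the induction is on k
alone. *)
Lemma dpow_heisenberg_chain x w (Y : nat -> A) k : GRing.comm x w ->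
  (forall a, x * Y a = Y a * x + Y a.+1 * w) ->
  dpow x k * Y 0 = \sum_(a < k.+1) Y a * dpow w a * dpow x (k - a).
Proof.
move=> xw xY; elim: k => [|k IH]; first by rewrite big_ord1 !dpow0 mul1r !mulr1.
apply: (@mulrSn_inj k); rewrite -mulrnAl dpowS -mulrA IH mulr_sumr -sumrMnl.
rewrite -(@sum_shiftD _ (fun a => Y a.+1 * dpow w a.+1 * dpow x (k - a) *+ a.+1)
            (fun a => Y a * dpow w a * dpow x (k - a).+1 *+ (k - a).+1)
            (fun a => Y a * dpow w a * dpow x (k.+1 - a) *+ k.+1)).
- apply: eq_bigr => -[a /=]; rewrite ltnS => le_ak _.
  have -> : Y a.+1 * dpow w a.+1 * dpow x (k - a) *+ a.+1 =
            Y a.+1 * (w * dpow w a) * dpow x (k - a).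
    by rewrite -dpowS mulrnAr mulrnAl.
  rewrite -mulrnAr dpowS !mulrA xY addrC !mulrDl; congr (_ + _ * _).
  by rewrite -!mulrA; congr (_ * _); apply/commr_sym/dpow_comm/commr_sym.
- by rewrite !subn0.
- by rewrite !subnn.
move=> a lt_ak; rewrite subSS subnSK // -mulrnDr.
by rewrite addSn subnKC // ltnW.
Qed.

(** The coefficient recursion in the induction step of Kostant's commutation
rule, with z the argument of the binomial for k + 1 and a + 1, and d = k - a. *)
Lemma kostant_step z a d :
  (z + d%:R) * hbin (z - 1) a + hbin (z - 1) a.+1 *+ d =
  hbin z a.+1 *+ (a.+1 + d).
Proof.
rewrite mulrDl -hbinSl mulr_natl -addrA -mulrnDl [X in _ + X *+ d]addrC.
by rewrite hbin_pascal -mulrnDr.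
Qed.

(** The counterpart of the previous lemma for an sl2-triple (x, h, y) and Y_a =
y^(l - a). *)
Lemma dpow_sl2_chain x h (l : nat) (Y : nat -> A) k : h * x = x * (h + 2%:R) ->
  (forall a, x * Y a = Y a * x + Y a.+1 * (h - l%:R + a.+1%:R)) ->
  dpow x k * Y 0 =
  \sum_(a < k.+1) Y a *
     hbin (h + (- k%:Z - l%:Z + (2 * a)%N%:Z)%:~R) a * dpow x (k - a).
Proof.
move=> hx xY; elim: k => [|k IH].
  by rewrite big_ord1 !dpow0 hbin0 mul1r !mulr1.
pose c k a : int := - k%:Z - l%:Z + (2 * a)%N%:Z.
have cS b : c k.+1 b.+1 = c k b + 1 by rewrite /c; lia.
have cS2 b : c k b.+1 - 2 = c k b by rewrite /c; lia.
have zE a d : (a + d = k)%N ->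
    h - l%:R + a.+1%:R = h + (c k a + 1)%:~R + d%:R.
  move=> <-; rewrite -!addrA; congr (_ + _).
  rewrite -[l%:R]/(l%:Z%:~R) -[a.+1%:R]/(a.+1%:Z%:~R) -[d%:R]/(d%:Z%:~R).
  by rewrite addrC -intrB -intrD; congr (_ %:~R); rewrite /c; lia.
have z1 a : h + (c k a + 1)%:~R - 1 = h + (c k a)%:~R.
  by rewrite intrD addrA addrK.
apply: (@mulrSn_inj k); rewrite -mulrnAl dpowS -mulrA IH mulr_sumr -sumrMnl.
rewrite -(@sum_shiftD _
  (fun a => Y a.+1 * ((h - l%:R + a.+1%:R) * hbin (h + (c k a)%:~R) a)
               * dpow x (k - a))
  (fun a => Y a * hbin (h + (c k a - 2)%:~R) a * dpow x (k - a).+1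
               *+ (k - a).+1)
  (fun a => Y a * hbin (h + (c k.+1 a)%:~R) a * dpow x (k.+1 - a) *+ k.+1)).
- apply: eq_bigr => -[a /=]; rewrite ltnS => le_ak _; rewrite -/(c k a).
  rewrite -mulrnAr dpowS !mulrA xY addrC !mulrDl; congr (_ + _ * _).
  rewrite -!mulrA; congr (_ * _); apply/esym/hbin_intertwine.
  rewrite mulrDl hx -(commr_int x) -mulrDr -addrA -[2%:R]/(2%:Z%:~R) -intrD.
  by rewrite [2%:Z + _]addrC subrK.
- by rewrite !subn0 !hbin0.
- rewrite !subnn !dpow0 !mulr1 -mulrnAr; congr (_ * _).
  by rewrite cS hbinSl z1 (zE k 0%N) ?addn0 // addr0.
move=> a lt_ak; rewrite subSS subnSK // cS cS2.
rewrite -!(mulrA (Y _)) -!mulrnAr -mulrDr; congr (_ * _).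
rewrite !mulrnAr -!mulrnAl -mulrDl; congr (_ * _).
rewrite (zE a (k - a)%N) ?subnKC ?(ltnW lt_ak) //.
by rewrite -z1 kostant_step addSn subnKC ?(ltnW lt_ak).
Qed.

Lemma dpow_weight h y (s : int) k : h * y = y * (h + s%:~R) ->
  h * dpow y k = dpow y k * (h + (s *+ k)%:~R).
Proof.
move=> hy; elim: k => [|k IH]; first by rewrite dpow0 mul1r addr0 mulr1.
apply: (@mulrSn_inj k);
  rewrite -mulrnAr dpowSr mulrA IH -mulrnAl dpowSr -!mulrA.
congr (_ * _); rewrite mulrDl hy -commr_int -mulrDr -addrA -intrD.
by rewrite mulrS.
Qed.

(** The weight of y under h = [x, y] is written 2s because the induction on b
adds up the shifts 0, 2s, 4s, ... to s b (b + 1). The case s = 0 is a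
Heisenberg triple and s = -1 an sl2-triple. *)
Lemma mulr_dpow x y h (s : int) b : x * y = y * x + h ->
  h * y = y * (h + (s *+ 2)%:~R) ->
  x * dpow y b.+1 = dpow y b.+1 * x + dpow y b * (h + (s *+ b)%:~R).
Proof.
move=> xy hy; elim: b => [|b IH]; first by rewrite dpow0 dpow1 mul1r addr0.
apply: (@mulrSn_inj b.+1); rewrite mulrnDl -[in LHS]mulrnAr dpowS.
rewrite mulrA xy mulrDl -!mulrA IH mulrDr.
rewrite -addrA (dpow_weight _ hy) mulrA -mulrnAl dpowS; congr (_ + _).
rewrite mulrA -dpowS mulrnAl -!mulrnAr -mulrDr; congr (_ * _).
rewrite !mulrnDl addrACA -mulrSr; congr (_ + _).
rewrite -!rmorphMn /= -intrD; congr (_ %:~R).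
by rewrite -!mulrnA -!mulrnDr; congr (_ *+ _); lia.
Qed.

Lemma dpow_heisenberg x y w k l :
  x * y = y * x + w -> GRing.comm x w -> GRing.comm y w ->
  dpow x k * dpow y l =
  \sum_(a < (minn k l).+1) dpow y (l - a) * dpow w a * dpow x (k - a).
Proof.
move=> xy xw yw.
pose Y a := if (a <= l)%N then dpow y (l - a) else 0.
have -> : dpow y l = Y 0 by rewrite /Y subn0.
rewrite (@dpow_heisenberg_chain x w) // => [|a]; last first.
  rewrite /Y; have [lt_al|gt_al|->] := ltngtP a l.
  - rewrite -subnSK // (@mulr_dpow _ _ w 0) ?mul0rn ?addr0 //.
  - by rewrite mulr0 !mul0r addr0.
  by rewrite subnn dpow0 mul0r addr0 mulr1 mul1r.
rewrite (@sum_minn _ (fun a => Y a * dpow w a * dpow x (k - a)) k l).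
  apply: eq_bigr => -[a /=]; rewrite ltnS leq_min => /andP[_ le_al] _.
  by rewrite /Y le_al.
by move=> a lt_la; rewrite /Y leqNgt lt_la !mul0r.
Qed.

Lemma dpow_kostant x y h k l : x * y = y * x + h ->
  h * x = x * (h + 2%:R) -> h * y = y * (h - 2%:R) ->
  dpow x k * dpow y l =
  \sum_(a < (minn k l).+1) dpow y (l - a) *
     hbin (h + (- k%:Z - l%:Z + (2 * a)%N%:Z)%:~R) a * dpow x (k - a).
Proof.
move=> xy hx hy.
pose Y a := if (a <= l)%N then dpow y (l - a) else 0.
have -> : dpow y l = Y 0 by rewrite /Y subn0.
rewrite (@dpow_sl2_chain x h l) // => [|a]; last first.
  rewrite /Y; have [lt_al|gt_al|->] := ltngtP a l.
  - rewrite -subnSK // (@mulr_dpow _ _ h (-1)) // -addrA;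
      congr (_ + _ * (_ + _)).
    rewrite -[l%:R]/(l%:Z%:~R) -[a.+1%:R]/(a.+1%:Z%:~R) addrC -intrB.
    by congr (_ %:~R); lia.
  - by rewrite mulr0 !mul0r addr0.
  by rewrite subnn dpow0 mul0r addr0 mulr1 mul1r.
rewrite (@sum_minn _ (fun a => Y a *
     hbin (h + (- k%:Z - l%:Z + (2 * a)%N%:Z)%:~R) a * dpow x (k - a)) k l).
  apply: eq_bigr => -[a /=]; rewrite ltnS leq_min => /andP[_ le_al] _.
  by rewrite /Y le_al.
by move=> a lt_la; rewrite /Y leqNgt lt_la !mul0r.
Qed.
End DividedPowers.

(** * Binomial coefficients modulo a prime *)

(** Kummer's theorem, by Legendre's formula: the quotient of a + b by p^j
exceeds the sum of those of a and b exactly when there is a carry out of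
position j - 1. *)
Lemma logn_bin p a b : prime p ->
  logn p 'C(a + b, a) =
  (\sum_(1 <= j < (a + b).+1) (p ^ j <= a %% p ^ j + b %% p ^ j))%N.
Proof.
move=> p_pr; have p_gt1 := prime_gt1 p_pr.
have logfact k : (k <= a + b)%N ->
    logn p k`! = (\sum_(1 <= j < (a + b).+1) k %/ p ^ j)%N.
  move=> le_k; rewrite logn_fact // [RHS](@big_cat_nat _ _ _ k.+1) //=.
  rewrite [X in (_ + X)%N]big_nat [X in (_ + X)%N]big1 ?addn0 // =>
    j /andP[lt_kj _].
  exact/divn_small/(ltn_trans lt_kj)/ltn_expl.
apply: (@addIn (logn p (a`! * b`!))).
rewrite -lognM ?muln_gt0 ?fact_gt0 ?bin_gt0 ?leq_addr //.
have -> : ('C(a + b, a) * (a`! * b`!) = (a + b)`!)%N.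
  by rewrite -(bin_fact (leq_addr b a)) addKn.
rewrite lognM ?fact_gt0 // !logfact ?leq_addr ?leq_addl // -!big_split /=.
by apply: eq_bigr => j _; rewrite divnD ?expn_gt0 ?prime_gt0 // addnC addnA.
Qed.

(** There is a carry out of position m - 1. *)
Lemma dvdn_bin_carry p m a b : prime p -> (a < p ^ m)%N -> (b < p ^ m)%N ->
  (p ^ m <= a + b)%N -> (p %| 'C(a + b, a))%N.
Proof.
move=> p_pr lt_a lt_b le_q; have p_gt1 := prime_gt1 p_pr.
have m_gt0 : (0 < m)%N by case: m lt_a lt_b le_q => //; rewrite expn0; lia.
have lt_m : (m < (a + b).+1)%N.
  exact: leq_trans (ltnW (ltn_expl m p_gt1)) le_q.
have : (0 < logn p 'C(a + b, a))%N.
  rewrite logn_bin // (@big_cat_nat _ _ _ m) //=; last exact: ltnW.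
  by rewrite [X in (_ + X)%N]big_ltn // !modn_small // le_q addnCA.
by rewrite logn_gt0 mem_primes => /and3P[].
Qed.

(** Adding the leading power of p to the remaining digits produces no carry. *)
Lemma coprime_bin_top p u a : prime p -> (a + p ^ u < p ^ u.+1)%N ->
  ~~ (p %| 'C(a + p ^ u, a))%N.
Proof.
move=> p_pr lt_a; have p_gt1 := prime_gt1 p_pr.
have : logn p 'C(a + p ^ u, a) = 0%N.
  rewrite logn_bin //; apply: big1_seq => j /=;
    rewrite mem_index_iota => /andP[j_gt0 _].
  apply/eqP; rewrite eqb0 -ltnNge; have [le_ju|lt_uj] := leqP j u.
    by rewrite (eqP (dvdn_exp2l p le_ju)) addn0 ltn_mod expn_gt0 ltnW.
  rewrite (leq_ltn_trans (leq_add (leq_mod _ _) (leq_mod _ _))) //.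
  by rewrite (leq_trans lt_a) // leq_exp2l.
move=> log0; apply/negP => p_dvd.
have : p \in primes 'C(a + p ^ u, a).
  by rewrite mem_primes p_pr bin_gt0 leq_addr.
by rewrite -logn_gt0 log0.
Qed.

(** * The evaluation morphism *)

Section Pres.
Context (n : nat) (U : algType rat) (iota : {linear 'M[rat]_n -> U}).
Context (K : fieldType) (D : algType K) (theta : {rmorphism UZ iota -> D}).
Context (q : nat).
Local Notation F := {malg K[{fmonom gen n q}]}.
Implicit Types (f g : F) (c : K).

(** Scalars are central: multiplication by a constant on either side is
scaling. *)
Lemma malg_scaleAr c f g : c *: (f * g) = f * (c *: g).
Proof.
have comC : f * c%:MP = c *: f.
  rewrite malgM_def fgmulgU malgZ_def; apply: eq_bigr => k _.
  by rewrite mulm1 mulrC.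
by rewrite -mul_malgC -[in RHS]mul_malgC !mulrA comC mul_malgC.
Qed.

Definition word (s : seq (gen n q)) : F := \prod_(x <- s) << fmu x >>.

Lemma wordE (w : {fmonom gen n q}) : << w >> = word w.
Proof.
case: w => s; rewrite /word /=; elim: s => [|x s IH].
  by rewrite big_nil -fmoneE.
rewrite big_cons -IH malgM_def fgmulUU mulr1; congr << _ >>.
by apply/eqP; rewrite fmP fmM fmU.
Qed.

Lemma malg_word f : f = \sum_(w <- msupp f) f@_w *: word w.
Proof.
rewrite {1}[f]monalgE; apply: eq_bigr => w _.
rewrite -wordE -mul_malgC malgM_def fgmulUU mulr1; congr << _ *g _ >>.
by apply/eqP; rewrite fmP fmM fm1.
Qed.

Lemma malg_word_ind (P : F -> Prop) : P 0 ->
  (forall f g, P f -> P g -> P (f + g)) -> (forall c f, P f -> P (c *: f)) ->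
  (forall s, P (word s)) -> forall f, P f.
Proof.
move=> P0 PD PZ Pw f; rewrite [f]malg_word.
by elim/big_rec: _ => // w g _ Pg; apply/PD/Pg/PZ/Pw.
Qed.

Local Notation pres := (@pres n U iota K D theta q).
Local Notation gen_val := (@gen_val n U iota K D theta q).

Lemma presEw (d : {fset {fmonom gen n q}}) f : (msupp f `<=` d)%fset ->
  pres f = \sum_(w <- d) f@_w *: \prod_(x <- (w : seq (gen n q))) gen_val x.
Proof.
move=> le; rewrite [LHS](big_fset_incl _ le) => //= x xd /mcoeff_outdom ->.
by rewrite scale0r.
Qed.

Fact pres_is_linear : linear pres.
Proof.
move=> c f g; pose d := (msupp f `|` msupp g `|` msupp (c *: f + g))%fset.
rewrite !(@presEw d) /d ?fsubsetUr //.
- rewrite scaler_sumr -big_split; apply: eq_bigr => w _ /=.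
  by rewrite mcoeffD mcoeffZ scalerDl scalerA.
- by rewrite -fsetUA fsetUCA fsubsetUl.
by rewrite -fsetUA fsubsetUl.
Qed.
HB.instance Definition _ := GRing.isLinear.Build K F D *:%R pres pres_is_linear.

Lemma presD f g : pres (f + g) = pres f + pres g. Proof. exact: linearD. Qed.
Lemma presZ c f : pres (c *: f) = c *: pres f. Proof. exact: linearZ. Qed.

Lemma pres_word s : pres (word s) = \prod_(x <- s) gen_val x.
Proof.
rewrite -(wordE (FMonom s)) /Defs.pres msuppU1 big_seq_fset1.
by rewrite mcoeffUU scale1r.
Qed.

Lemma word_cat s t : word (s ++ t) = word s * word t.
Proof. by rewrite /word big_cat. Qed.

Fact pres_is_multiplicative : multiplicative pres.
Proof.
split=> [f g|]; last by have := pres_word [::]; rewrite /word !big_nil.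
elim/malg_word_ind: f => [|f1 f2 IH1 IH2|c f IH|s].
- by rewrite !(mul0r, linear0).
- by rewrite presD [RHS]mulrDl -IH1 -IH2 -presD -mulrDl.
- by rewrite presZ -[RHS]scalerAl -IH -presZ scalerAl.
elim/malg_word_ind: g => [|f1 f2 IH1 IH2|c f IH|t].
- by rewrite !(mulr0, linear0).
- by rewrite presD [RHS]mulrDr -IH1 -IH2 -presD -mulrDr.
- by rewrite presZ -[RHS]scalerAr -IH -presZ malg_scaleAr.
by rewrite -word_cat !pres_word big_cat.
Qed.
HB.instance Definition _ :=
  GRing.isMultiplicative.Build F D pres pres_is_multiplicative.

Lemma Dist_pres y : Dist theta q y <-> exists f : freeAlg n q K, y = pres f.
Proof.
split=> [|[f ->]].
  elim=> {y} [y [i k|a k]||c y _ [f ->]|y z _ [f ->] _ [g ->]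
             |y z _ [f ->] _ [g ->]].
  - by exists (word [:: inl (i, k)]); rewrite pres_word big_seq1.
  - by exists (word [:: inr (a, k)]); rewrite pres_word big_seq1.
  - by exists 1; rewrite rmorph1.
  - by exists (c *: f); rewrite presZ.
  - by exists (f + g); rewrite presD.
  - by exists (f * g); rewrite rmorphM.
elim/malg_word_ind: f => [|f g Df Dg|c f Df|s].
- by rewrite linear0 -(scale0r 1); apply/subalg_gen_Z/subalg_gen_1.
- by rewrite presD; apply: subalg_gen_D.
- by rewrite presZ; apply: subalg_gen_Z.
rewrite pres_word; elim: s => [|x s IH]; first by rewrite big_nil;
  apply: subalg_gen_1.
rewrite big_cons; apply: subalg_gen_M IH; apply: subalg_gen_in.
by case: x => -[]; [apply: dist_gen_H|apply: dist_gen_X].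
Qed.
End Pres.

(** * The relations hold in the distribution algebra *)

Section Soundness.
Context (n : nat) (U : algType rat) (iota : {linear 'M[rat]_n -> U}).
Context (K : fieldType) (D : algType K) (theta : {rmorphism UZ iota -> D}).
Context (p m : nat).
Local Notation q := (p ^ m)%N.
Local Notation F := {malg K[{fmonom gen n q}]}.
Local Notation pres := (@pres n U iota K D theta q).
Local Notation hsym := (@hsym n K p m).
Local Notation xsym := (@xsym n K p m).
Local Notation H i := (iota (delta_mx i i)).
Local Notation Xr al := (iota (delta_mx (src al) (tgt al))).

(** Relations are verified in U, where divided powers can be computed with, and
transported to D through the injection of the Kostant form into U: two elements
of the free algebra lifting to the same element of U have the same image. *)
Definition lifts (f : F) (u : U) :=
  exists2 z : UZ iota, pres f = theta z & \val z = u.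

Lemma lifts_eq f g u : lifts f u -> lifts g u -> pres f = pres g.
Proof. by move=> [z -> <-] [z' -> /val_inj->]. Qed.

Lemma lifts1 : lifts 1 1.
Proof. by exists 1; rewrite ?rmorph1. Qed.

Lemma lifts0 : lifts 0 0.
Proof. by exists 0; rewrite ?raddf0. Qed.

Lemma liftsD f g u v : lifts f u -> lifts g v -> lifts (f + g) (u + v).
Proof. by move=> [z fz <-] [z' gz <-]; exists (z + z');
  rewrite ?presD ?raddfD //= fz gz. Qed.

Lemma liftsM f g u v : lifts f u -> lifts g v -> lifts (f * g) (u * v).
Proof. by move=> [z fz <-] [z' gz <-]; exists (z * z');
  rewrite ?rmorphM //= fz gz. Qed.

Lemma liftsZ (c : int) f u : lifts f u -> lifts (c%:~R *: f) (c%:~R * u).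
Proof.
move=> [z fz <-]; exists (z *~ c).
  by rewrite presZ fz scaler_int raddfMz.
by rewrite raddfMz mulrzl.
Qed.

Lemma lifts_sum N (f : 'I_N -> F) (u : 'I_N -> U) :
  (forall i, lifts (f i) (u i)) -> lifts (\sum_i f i) (\sum_i u i).
Proof.
move=> fu; elim/big_rec2: _ => [|i f' u' _]; first exact: lifts0.
exact: liftsD.
Qed.

Lemma pres_var x : pres (@var n K p m x) = gen_val theta x.
Proof. by have := pres_word theta [:: x]; rewrite /word !big_seq1. Qed.

Lemma lifts_h i a : (a < q)%N -> lifts (hsym i a) (hbin (H i) a).
Proof.
move=> lt_aq; rewrite /hsym insubT; exists (HZ iota i a) => //.
by rewrite pres_var.
Qed.

Lemma lifts_x al k : (k < q)%N -> lifts (xsym al k) (dpow (Xr al) k).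
Proof.
move=> lt_aq; rewrite /xsym insubT; exists (XZ iota al k) => //.
by rewrite pres_var.
Qed.

Lemma lifts_hshift i z a : (a < q)%N ->
  lifts (@hshift n K p m i z a) (hbin (H i + z%:~R) a).
Proof.
move=> lt_aq; rewrite hbin_shift; apply: lifts_sum => t; apply: liftsZ.
by apply: lifts_h; apply: leq_ltn_trans lt_aq; rewrite -ltnS.
Qed.

Lemma lifts_hneg i b : (b < q)%N -> lifts (@hneg n K p m i b) (hbin (- H i) b).
Proof.
move=> lt_bq; rewrite hbinN.
have -> : (-1) ^+ b = ((-1) ^+ b : int)%:~R :> U by rewrite rmorphXn rmorphN1.
rewrite /hneg.
have -> : (-1) ^+ b = ((-1) ^+ b : int)%:~R :> K by rewrite rmorphXn rmorphN1.
exact/liftsZ/lifts_hshift.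
Qed.

Context (iota_lie : lie_morphism iota) (charK : p \in [pchar K]).

Lemma lie_delta i j k l :
  iota (delta_mx i j) * iota (delta_mx k l) =
  iota (delta_mx k l) * iota (delta_mx i j) +
  (iota (delta_mx i l) *+ (j == k) - iota (delta_mx k j) *+ (l == i)).
Proof.
have := iota_lie (delta_mx i j) (delta_mx k l).
rewrite !mul_delta_mx_cond linearB !linearMn /= => ->.
by rewrite addrC subrK.
Qed.

Lemma lie_H_comm i j : GRing.comm (H i) (H j).
Proof.
rewrite /GRing.comm lie_delta eq_sym; case: eqP => [->|];
  last by rewrite subrr addr0.
by rewrite subrr addr0.
Qed.

Lemma lifts_hroot al (c : int) a : (a < q)%N ->
  lifts (@hroot n K p m al c a) (hbin (H (src al) - H (tgt al) + c%:~R) a).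
Proof.
move=> lt_aq.
have lt_q t : (t < a.+1)%N -> (t < q)%N.
  by rewrite ltnS => /leq_ltn_trans; apply.
rewrite -addrA hbinD; last first.
  by apply: commrD; [apply/commrN/lie_H_comm|apply: commr_int].
apply: lifts_sum => t; rewrite hbin_shift mulr_sumr; apply: lifts_sum => s.
rewrite mulrA commr_int -mulrA; apply/liftsZ/liftsM; first exact/lifts_h/lt_q.
apply/lifts_hneg/lt_q; rewrite (leq_trans (ltn_ord s)) // ltnS leq_subr //.
Qed.

Let p_pr : prime p. Proof. by case/andP: charK. Qed.

(** The symbol f of index a is read as 0 when a reaches q, while its lift z
need not be 0; both sides vanish in D because the coefficient is divisible by
p. *)
Lemma lifts_trunc (c a : nat) (f : F) (z : UZ iota) :
  ((a < q)%N -> pres f = theta z) -> ((q <= a)%N -> (p %| c)%N) ->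
  lifts (c%:R *: f) (\val z *+ c).
Proof.
move=> fz dvd_c; exists (z *+ c); last by rewrite raddfMn.
rewrite presZ raddfMn /=; have [lt_aq|le_qa] := ltnP a q.
  by rewrite fz // scaler_nat.
have c0 : c%:R = 0 :> K by apply/eqP; rewrite -(dvdn_pcharf charK) dvd_c.
by rewrite -[RHS]scaler_nat c0 !scale0r.
Qed.

Lemma lifts_hsymn i a c : ((q <= a)%N -> (p %| c)%N) ->
  lifts (c%:R *: hsym i a) (hbin (H i) a *+ c).
Proof.
apply: (@lifts_trunc c a (hsym i a) (HZ iota i a)) => lt_aq.
by rewrite /hsym insubT pres_var.
Qed.

Lemma lifts_xsymn al a c : ((q <= a)%N -> (p %| c)%N) ->
  lifts (c%:R *: xsym al a) (dpow (Xr al) a *+ c).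
Proof.
apply: (@lifts_trunc c a (xsym al a) (XZ iota al a)) => lt_aq.
by rewrite /xsym insubT pres_var.
Qed.

Lemma rvecE (al : Phi n) x :
  rvec al 0 x = (src al == x)%:Z - (tgt al == x)%:Z.
Proof. by rewrite /rvec !mxE !eqxx /= ![x == _]eq_sym !mulrb;
  do 2!case: eqP. Qed.

(** If neither pair of inner indices agrees, then the source of ga must be both
the source of al and that of be, which would have to be counted twice. *)
Lemma rvec_add_root (al be ga : Phi n) : rvec al + rvec be = rvec ga ->
  [/\ tgt al = src be, src al <> tgt be, src ga = src al & tgt ga = tgt be] \/
  [/\ src al = tgt be, tgt al <> src be, src ga = src be & tgt ga = tgt al].
Proof.
move=> /rowP eq_abg.
have E x : (src al == x)%:Z - (tgt al == x)%:Z
      + (src be == x)%:Z - (tgt be == x)%:Z =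
    (src ga == x)%:Z - (tgt ga == x)%:Z.
  by rewrite -(rvecE ga) -eq_abg mxE !rvecE addrA.
have := (valP al, valP be, valP ga).
move: al be ga E {eq_abg} => [[i j] /= ij] [[k l] /= kl] [[s t] /= st].
rewrite /src /tgt /= => E _.
have [jk|jk] := eqVneq j k.
  have {}E x : (i == x)%:Z - (l == x)%:Z = (s == x)%:Z - (t == x)%:Z.
    by rewrite -E jk subrK.
  have si : s = i.
    by have := E s; rewrite eqxx eq_sym [t == s]eq_sym (negbTE st); case: eqP;
      case: eqP.
  have tl : t = l.
    by have := E t; rewrite eqxx (negbTE st) [l == t]eq_sym; case: eqP;
      case: eqP.
  by left; split=> // il; move: st; rewrite si tl il eqxx.
have [il|il] := eqVneq i l.
  have {}E x : (k == x)%:Z - (j == x)%:Z = (s == x)%:Z - (t == x)%:Z.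
    by rewrite -E -il [RHS]addrAC [X in _ = X + _]addrAC subrr add0r addrC.
  have sk : s = k.
    by have := E s; rewrite eqxx [k == s]eq_sym [t == s]eq_sym (negbTE st);
      case: eqP; case: eqP.
  have tj : t = j.
    by have := E t; rewrite eqxx (negbTE st) [j == t]eq_sym; case: eqP;
      case: eqP.
  by right; split=> // /eqP; rewrite (negbTE jk).
have si : s = i.
  have := E i; rewrite eqxx eq_sym (negbTE ij) [l == i]eq_sym (negbTE il).
  by case: (k == i); case: (s =P i); case: (t == i).
have sk : s = k.
  have := E k; rewrite eqxx (negbTE jk) [l == k]eq_sym (negbTE kl).
  by case: (i == k); case: (s =P k); case: (t == k).
have ki : k = i by rewrite -sk.
move: (E i); rewrite ki si !eqxx eq_sym (negbTE ij) [l == i]eq_sym (negbTE il).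
by case: (t == i).
Qed.

(** The root al takes the values 1, -1 and 0 on H_i. *)
Lemma root_weight i (al : Phi n) :
  H i * Xr al = Xr al * (H i + ((i == src al)%:Z - (i == tgt al)%:Z)%:~R).
Proof.
rewrite lie_delta mulrDr; congr (_ + _); rewrite intrB mulrBr.
rewrite !mulr_natr [tgt al == i]eq_sym.
by congr (_ - _); [case: eqP => [->|]|case: eqP => [->|]].
Qed.

Lemma hbin_dpow i (al : Phi n) s a k :
  (i == src al)%:Z - (i == tgt al)%:Z = s ->
  hbin (H i) a * dpow (Xr al) k = dpow (Xr al) k * hbin (H i + (s *+ k)%:~R) a.
Proof. by move=> <-; apply/hbin_intertwine/dpow_weight/root_weight. Qed.

Lemma dpow_hbin i (al : Phi n) s a k :
  (i == src al)%:Z - (i == tgt al)%:Z = s ->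
  dpow (Xr al) k * hbin (H i) a =
  hbin (H i + (- s *+ k)%:~R) a * dpow (Xr al) k.
Proof.
move=> eq_s; apply/esym/hbin_intertwine.
rewrite mulrDl (dpow_weight _ (root_weight i al)) eq_s -commr_int -mulrDr.
by rewrite -addrA -intrD mulNrn subrr addr0.
Qed.

Lemma defrel_sound f g : defrel f g -> pres f = pres g.
Proof.
have q_gt0 : (0 < q)%N by rewrite expn_gt0 prime_gt0.
have ltq u : (u < m)%N -> (p ^ u < q)%N by rewrite ltn_exp2l // prime_gt1.
case=> {f g}.
- move=> i; apply: (lifts_eq (lifts_h i q_gt0)); rewrite hbin0; exact: lifts1.
- move=> i a b lt_a lt_b;
    apply: (lifts_eq (liftsM (lifts_h i lt_a) (lifts_h i lt_b))).
  rewrite hbinM; apply: lifts_sum => -[c /=];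
    rewrite ltnS leq_min => /andP[le_ca le_cb].
  apply: lifts_hsymn => le_q; rewrite dvdn_mulr //.
  have -> : (a + b - c = (a - c) + b)%N by rewrite addnBAC.
  apply: (@dvdn_bin_carry p m) => //;
    first exact: leq_ltn_trans (leq_subr _ _) lt_a.
  by rewrite addnBAC.
- move=> al k l lt_k lt_l;
    apply: (lifts_eq (liftsM (lifts_x al lt_k) (lifts_x al lt_l))).
  rewrite dpowM; apply: lifts_xsymn => le_q; exact: (@dvdn_bin_carry p m).
- move=> al; apply: (lifts_eq (lifts_x al q_gt0)); rewrite dpow0; exact: lifts1.
- move=> i j u v /ltq ltu /ltq ltv.
  apply: (lifts_eq (liftsM (lifts_h i ltu) (lifts_h j ltv))).
  rewrite (hbin_comm _ (commr_sym (hbin_comm _ (lie_H_comm j i)))).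
  by apply: liftsM; apply: lifts_h.
- move=> al be ga u v /ltq ltu /ltq ltv abg.
  apply: (lifts_eq (liftsM (lifts_x al ltu) (lifts_x be ltv))).
  have bracket : Xr al * Xr be = Xr be * Xr al + (cst al be)%:~R * Xr ga.
    rewrite lie_delta /cst; case: (rvec_add_root abg) => -[e ne -> ->].
      by rewrite e eqxx eq_sym (introF eqP ne) subr0 mul1r.
    by rewrite e eqxx (introF eqP ne) sub0r mulN1r.
  have comm_ga de :
    de = al \/ de = be -> GRing.comm (Xr de) ((cst al be)%:~R * Xr ga).
    move=> de_ab; apply: commrM; first exact: commr_int.
    rewrite /GRing.comm lie_delta.
    have [/eqP n1 /eqP n2] : tgt de <> src ga /\ tgt ga <> src de.
      have alP : src al <> tgt al by apply/eqP; exact: (valP al).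
      have beP : src be <> tgt be by apply/eqP; exact: (valP be).
      case: (rvec_add_root abg) => -[_ ne -> ->].
        by case: de_ab => ->; split=> // /esym.
      by case: de_ab => ->; split=> // /esym.
    by rewrite (negbTE n1) (negbTE n2) subrr addr0.
  have comm_al := comm_ga _ (or_introl erefl).
  have comm_be := comm_ga _ (or_intror erefl).
  rewrite (dpow_heisenberg _ _ bracket comm_al comm_be).
  apply: lifts_sum => -[a /=]; rewrite ltnS leq_min => /andP[le_au le_av].
  rewrite dpowZ mulrA commr_int -!mulrA; apply/liftsZ; rewrite !mulrA.
  apply/liftsM; first apply/liftsM; apply: lifts_x.
  - exact: leq_ltn_trans (leq_subr _ _) ltv.
  - exact: leq_ltn_trans le_au ltu.
  exact: leq_ltn_trans (leq_subr _ _) ltu.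
- move=> al u v /ltq ltu /ltq ltv.
  apply: (lifts_eq (liftsM (lifts_x al ltu) (lifts_x (ropp al) ltv))).
  have h2 : H (src al) - H (tgt al) =
      Xr al * Xr (ropp al) - Xr (ropp al) * Xr al.
    by rewrite lie_delta !eqxx [RHS]addrC addKr.
  have al_neq : src al == tgt al = false by apply/negbTE; exact: (valP al).
  have tgt_neq : tgt al == src al = false by rewrite eq_sym.
  have srcN : src (ropp al) = tgt al by [].
  have tgtN : tgt (ropp al) = src al by [].
  rewrite (@dpow_kostant _ _ _ (H (src al) - H (tgt al))).
  - apply: lifts_sum => -[a /=]; rewrite ltnS leq_min => /andP[le_au le_av].
    apply/liftsM; first apply/liftsM.
    + exact/lifts_x/(leq_ltn_trans (leq_subr _ _) ltv).
    + exact/lifts_hroot/(leq_ltn_trans le_au ltu).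
    exact/lifts_x/(leq_ltn_trans (leq_subr _ _) ltu).
  - by rewrite h2 addrC subrK.
  - rewrite mulrBl !root_weight !eqxx al_neq tgt_neq -mulrBr.
    by rewrite opprD addrACA -intrB.
  rewrite mulrBl !root_weight srcN tgtN !eqxx al_neq tgt_neq -mulrBr.
  by rewrite opprD addrACA -intrB.
- move=> al be u v /ltq ltu /ltq ltv ab0 abn.
  apply: (lifts_eq (liftsM (lifts_x al ltu) (lifts_x be ltv))).
  have ab : GRing.comm (Xr al) (Xr be).
    rewrite /GRing.comm lie_delta.
    have [jk|jk] := eqVneq (tgt al) (src be).
      have [il|il] := eqVneq (src al) (tgt be).
        by case: ab0; rewrite /rvec jk il addrC subrKA subrr.
      case: (abn (Sub (src al, tgt be) il)).
      by rewrite /rvec /src /tgt /= -/(tgt al) -/(src be) jk addrA subrK.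
    have [il|il] := eqVneq (tgt be) (src al); last by rewrite subrr addr0.
    rewrite eq_sym in jk; case: (abn (Sub (src be, tgt al) jk)).
    by rewrite /rvec /src /tgt /= -/(tgt be) -/(src al) il addrC addrA subrK.
  rewrite (dpow_comm _ (commr_sym (dpow_comm _ (commr_sym ab)))).
  by apply: liftsM; apply: lifts_x.
- move=> al u v /ltq ltu /ltq ltv.
  apply: (lifts_eq (liftsM (lifts_h _ ltv) (lifts_x al ltu))).
  rewrite (@hbin_dpow _ _ 1); last by rewrite eqxx (negbTE (valP al)).
  rewrite natz; exact: liftsM (lifts_x al ltu) (lifts_hshift _ _ ltv).
- move=> al u v /ltq ltu /ltq ltv.
  apply: (lifts_eq (liftsM (lifts_h _ ltv) (lifts_x al ltu))).
  rewrite (@hbin_dpow _ _ (-1)); last first.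
    by rewrite eqxx eq_sym (negbTE (valP al)).
  rewrite mulNrn natz; exact: liftsM (lifts_x al ltu) (lifts_hshift _ _ ltv).
- move=> al l u v /ltq ltu /ltq ltv ls lt.
  apply: (lifts_eq (liftsM (lifts_h _ ltv) (lifts_x al ltu))).
  rewrite (@hbin_dpow _ _ 0); last by rewrite (negbTE ls) (negbTE lt).
  rewrite mul0rn addr0; exact: liftsM (lifts_x al ltu) (lifts_h _ ltv).
- move=> al u v /ltq ltu /ltq ltv.
  apply: (lifts_eq (liftsM (lifts_x al ltu) (lifts_h _ ltv))).
  rewrite (@dpow_hbin _ _ 1); last by rewrite eqxx (negbTE (valP al)).
  rewrite mulNrn natz; exact: liftsM (lifts_hshift _ _ ltv) (lifts_x al ltu).
move=> al u v /ltq ltu /ltq ltv.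
apply: (lifts_eq (liftsM (lifts_x al ltu) (lifts_h _ ltv))).
rewrite (@dpow_hbin _ _ (-1)); last by rewrite eqxx eq_sym (negbTE (valP al)).
rewrite opprK natz; exact: liftsM (lifts_hshift _ _ ltv) (lifts_x al ltu).
Qed.

Lemma ideal_sound f : ideal_gen (@relator n K p m) f -> pres f = 0.
Proof.
elim=> {f} [f [l [r [/defrel_sound lr ->]]]||f g _ f0 _ g0|f g _ g0|f g _ g0].
- by rewrite raddfB /= lr subrr.
- exact: raddf0.
- by rewrite presD f0 g0 addr0.
- by rewrite rmorphM /= g0 mulr0.
by rewrite rmorphM /= g0 mul0r.
Qed.
End Soundness.

(** * Straightening modulo lower degree *)

Section Straightening.
Context (K : fieldType) (A : lalgType K) (S : A -> Prop).
Hypothesis scaleAr : forall c (f g : A), c *: (f * g) = f * (c *: g).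
Local Notation I := (ideal_gen S).
Implicit Types (f g : A) (c : K) (W : A -> Prop) (d : nat).

Lemma ideal_genZ c f : I f -> I (c *: f).
Proof. by rewrite -[f in c *: f]mul1r scalerAl; apply: ideal_gen_Ml. Qed.

Inductive span_mod W : A -> Prop :=
| span_mod_ideal f : I f -> span_mod W f
| span_mod_in f : W f -> span_mod W f
| span_mod_D f g : span_mod W f -> span_mod W g -> span_mod W (f + g)
| span_mod_Z c f : span_mod W f -> span_mod W (c *: f).

Lemma span_mod_0 W : span_mod W 0.
Proof. exact/span_mod_ideal/ideal_gen_0. Qed.

Lemma span_mod_N W f : span_mod W f -> span_mod W (- f).
Proof. by rewrite -scaleN1r; apply: span_mod_Z. Qed.

Lemma span_mod_B W f g : span_mod W f -> span_mod W g -> span_mod W (f - g).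
Proof. by move=> Wf /span_mod_N; apply: span_mod_D. Qed.

Lemma span_mod_sum W N (f : 'I_N -> A) :
  (forall i, span_mod W (f i)) -> span_mod W (\sum_i f i).
Proof. by move=> Wf; elim/big_rec: _ => [|i g _];
  [apply: span_mod_0|apply: span_mod_D]. Qed.

Lemma span_mod_trans W W' f : (forall g, W g -> span_mod W' g) ->
  span_mod W f -> span_mod W' f.
Proof.
move=> WW'; elim=> {f} [f If|f /WW' //|f g _ IHf _ IHg|c f _ IHf].
- exact: span_mod_ideal.
- exact: span_mod_D.
exact: span_mod_Z.
Qed.

Lemma span_mod_subr W f g : span_mod W (f - g) -> span_mod W g -> span_mod W f.
Proof. by move=> Wfg Wg; rewrite -(subrK g f); apply: span_mod_D. Qed.

Context (J : finType) (y : J -> nat -> A) (p m : nat).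
Local Notation q := (p ^ m)%N.
Implicit Types (s t : seq (J * nat)) (i j : J) (k l : nat).

Definition wprod s : A := \prod_(x <- s) y x.1 x.2.
Definition wdeg s : nat := \sum_(x <- s) x.2.

(** The bound on the degree is strict, so that Fil 0 is the ideal itself and
the induction on the degree starts there. *)
Definition Fil d : A -> Prop :=
  span_mod (fun f => exists2 s, (wdeg s < d)%N & f = wprod s).

Lemma Fil_le d d' f : (d <= d')%N -> Fil d f -> Fil d' f.
Proof.
move=> le_d; apply: span_mod_trans => g [s lt_s ->].
by apply: span_mod_in; exists s => //; apply: leq_trans le_d.
Qed.

Lemma Fil_0 f : Fil 0 f -> I f.
Proof.
elim=> {f} [//|f [s]//|f g _ If _ Ig|c f _ If]; first exact: ideal_gen_D.
exact: ideal_genZ.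
Qed.

Lemma Fil_y j k : Fil k.+1 (y j k).
Proof.
apply: span_mod_in; exists [:: (j, k)]; last by rewrite /wprod big_seq1.
by rewrite /wdeg big_seq1.
Qed.

Lemma wprod_cat s t : wprod (s ++ t) = wprod s * wprod t.
Proof. by rewrite /wprod big_cat. Qed.

Lemma Fil_1 : Fil 1 1.
Proof. by apply: span_mod_in; exists [::]; rewrite /wdeg /wprod ?big_nil. Qed.

Lemma Fil_M a b f g : Fil a f -> Fil b g -> Fil (a + b).-1 (f * g).
Proof.
move=> Fa Fb; elim: Fa => {f} [f If|f [s lt_s ->]|f f' _ IH _ IH'|c f _ IH].
- exact/span_mod_ideal/ideal_gen_Mr.
- elim: Fb => {g} [g Ig|g [t lt_t ->]|g g' _ IH _ IH'|c g _ IH].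
  + exact/span_mod_ideal/ideal_gen_Ml.
  + apply: span_mod_in; exists (s ++ t); last by rewrite wprod_cat.
    by rewrite /wdeg big_cat /= -/(wdeg s) -/(wdeg t); lia.
  + by rewrite mulrDr; apply: span_mod_D.
  by rewrite -scaleAr; apply: span_mod_Z.
- by rewrite mulrDl; apply: span_mod_D.
by rewrite -scalerAl; apply: span_mod_Z.
Qed.

Lemma Fil_Ml k d f g : Fil k.+1 f -> Fil d g -> Fil (k + d) (f * g).
Proof. by move=> Ff Fg; have := Fil_M Ff Fg; rewrite addSn. Qed.

Lemma Fil_Mr k d f g : Fil d f -> Fil k.+1 g -> Fil (d + k) (f * g).
Proof. by move=> Ff Fg; have := Fil_M Ff Fg; rewrite addnS. Qed.

Hypothesis p_pr : prime p.
Hypothesis charK : p \in [pchar K].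
Hypothesis y_unit : forall j, I (y j 0 - 1).
Hypothesis y_big : forall j k, (q <= k)%N -> y j k = 0.
Hypothesis y_merge : forall j k l, (k < q)%N -> (l < q)%N ->
  Fil (k + l) (y j k * y j l - 'C(k + l, k)%:R *: y j (k + l)).
Hypothesis y_comm_pow : forall i j u v, (u < m)%N -> (v < m)%N ->
  Fil (p ^ u + p ^ v) (y i (p ^ u) * y j (p ^ v) - y j (p ^ v) * y i (p ^ u)).

Lemma y_merge_all j k l :
  Fil (k + l) (y j k * y j l - 'C(k + l, k)%:R *: y j (k + l)).
Proof.
have [/y_merge //|le_qk] := ltnP k q; last first.
  rewrite (y_big _ le_qk) (@y_big _ (k + l)) ?(leq_trans le_qk) ?leq_addr //.
  by rewrite scaler0 mul0r subr0; apply: span_mod_0.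
have [lt_lq /(_ _ _ lt_lq)//|le_ql] := ltnP l q => _.
rewrite (y_big _ le_ql) (@y_big _ (k + l)) ?(leq_trans le_ql) ?leq_addl //.
by rewrite scaler0 mulr0 subr0; apply: span_mod_0.
Qed.

(** With p^u the leading base p power of k and a = k - p^u, the coefficient of
y_k in the product y_a y_(p^u) is invertible by [coprime_bin_top], so y_k is a
multiple of that product modulo lower degree, and commutators with z follow
from those of y_a and y_(p^u). *)
Lemma y_comm_gen i l z : Fil l.+1 z ->
  (forall u, (u < m)%N ->
    Fil (p ^ u + l) (y i (p ^ u) * z - z * y i (p ^ u))) ->
  forall k, Fil (k + l) (y i k * z - z * y i k).
Proof.
move=> Fz comm_pow; elim/ltn_ind=> k IH; have p_gt1 := prime_gt1 p_pr.
have [lt_kq|le_qk] := ltnP k q; last first.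
  by rewrite y_big // mul0r mulr0 subr0; apply: span_mod_0.
case: k IH lt_kq => [|k] IH lt_kq.
  have -> : y i 0 * z - z * y i 0 = (y i 0 - 1) * z - z * (y i 0 - 1).
    by rewrite mulrBl mulrBr mul1r mulr1 opprB addrA subrK.
  apply: span_mod_B; apply: span_mod_ideal.
    exact/ideal_gen_Mr/y_unit.
  exact/ideal_gen_Ml/y_unit.
set u := trunc_log p k.+1.
have le_u : (p ^ u <= k.+1)%N by apply: trunc_logP.
have lt_u : (k.+1 < p ^ u.+1)%N by apply: trunc_log_ltn.
have lt_um : (u < m)%N by rewrite -(ltn_exp2l _ _ p_gt1) (leq_ltn_trans le_u).
move: (subnK le_u) lt_u; set a := (k.+1 - p ^ u)%N => eq_a lt_u.
have [a0|a_gt0] := posnP a; first by rewrite -eq_a a0; apply: comm_pow.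
have lt_a : (a < k.+1)%N by rewrite -eq_a -addn1 leq_add2l expn_gt0 ltnW.
rewrite -eq_a in lt_u *.
set c : K := 'C(a + p ^ u, a)%:R.
have c_neq0 : c != 0 by rewrite -(dvdn_pcharf charK) coprime_bin_top.
pose r := y i a * y i (p ^ u) - c *: y i (a + p ^ u).
have Fr : Fil (a + p ^ u) r by apply: y_merge_all.
have -> : y i (a + p ^ u) = c^-1 *: (y i a * y i (p ^ u) - r).
  by rewrite /r subKr scalerA mulVf // scale1r.
clearbody r.
have F1 : Fil (a + p ^ u + l) (r * z - z * r).
  by apply: span_mod_B; [apply: Fil_Mr|rewrite addnC; apply: Fil_Ml].
have F2 : Fil (a + p ^ u + l) (y i a * (y i (p ^ u) * z - z * y i (p ^ u))).
  by rewrite -addnA; apply: Fil_Ml; [apply: Fil_y|apply: comm_pow].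
have F3 : Fil (a + p ^ u + l) ((y i a * z - z * y i a) * y i (p ^ u)).
  by rewrite addnAC; apply: Fil_Mr; [apply: IH|apply: Fil_y].
rewrite -scalerAl -scaleAr -scalerBr; apply: span_mod_Z.
suff -> : (y i a * y i (p ^ u) - r) * z - z * (y i a * y i (p ^ u) - r) =
    y i a * (y i (p ^ u) * z - z * y i (p ^ u)) +
    (y i a * z - z * y i a) * y i (p ^ u) - (r * z - z * r).
  by apply: span_mod_B F1; apply: span_mod_D.
rewrite !mulrBl !mulrBr !mulrA.
by rewrite subrKA !opprB addrACA [RHS]addrACA [- (r * z) - _]addrC.
Qed.

Lemma y_comm i j k l : Fil (k + l) (y i k * y j l - y j l * y i k).
Proof.
apply: y_comm_gen => [|u lt_u]; first exact: Fil_y.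
rewrite addnC -opprB; apply: span_mod_N; apply: y_comm_gen => [|v lt_v];
  first exact: Fil_y.
exact: y_comm_pow.
Qed.

Definition mono (a : J -> nat) (e : seq J) : A := \prod_(j <- e) y j (a j).

Lemma Fil_mono a e : Fil (\sum_(j <- e) a j).+1 (mono a e).
Proof.
apply: span_mod_in; exists [seq (j, a j) | j <- e].
  by rewrite /wdeg big_map.
by rewrite /wprod big_map.
Qed.

(** Move y_j^(k) to the right up to its place in the ordered monomial and merge
it there. *)
Lemma mulr_mono j k (a : J -> nat) (e : seq J) : uniq e -> j \in e ->
  Fil (k + \sum_(i <- e) a i)
    (y j k * mono a e
     - 'C(k + a j, k)%:R *: mono (fun i =>
         if i == j then k + a j else a i)%N e).
Proof.
elim: e => // i e IH /andP[i_e e_uniq];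
  rewrite inE /mono !big_cons -!/(mono _ e).
move: i_e; have [<- j_e _|ne_ji _ /= j_e] := eqVneq j i.
  have -> : mono (fun i => if i == j then k + a j else a i)%N e = mono a e.
    apply: eq_big_seq => i' /= i'_e; case: eqP => // i'j.
    by rewrite -i'j i'_e in j_e.
  rewrite mulrA scalerAl -mulrBl addnA.
  by apply: Fil_Mr; [apply: y_merge_all|apply: Fil_mono].
set b := (X in _ *: (_ * X)); set c := _%:R.
have -> : y j k * (y i (a i) * mono a e) - c *: (y i (a i) * b) =
   (y j k * y i (a i) - y i (a i) * y j k) * mono a e +
   y i (a i) * (y j k * mono a e - c *: b).
  by rewrite mulrBl mulrBr scaleAr !mulrA addrA subrK.
apply: span_mod_D.
  by rewrite addnA; apply: Fil_Mr; [apply: y_comm|apply: Fil_mono].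
by rewrite addnCA; apply: Fil_Ml; [apply: Fil_y|apply: IH].
Qed.

Lemma wprod_mono s : exists c (a : J -> nat),
  (\sum_j a j = wdeg s)%N /\ Fil (wdeg s) (wprod s - c *: mono a (enum J)).
Proof.
elim: s => [|[j k] s [c [a [deg_a Fs]]]].
  exists 1, (fun=> 0%N); rewrite /wdeg /wprod !big_nil big1 //; split=> //.
  apply: span_mod_ideal; rewrite scale1r /mono.
  elim: (enum J) => [|j e IH]; first by rewrite big_nil subrr;
    apply: ideal_gen_0.
  rewrite big_cons; have -> (z z' : A) : 1 - z * z' = (1 - z') - (z - 1) * z'.
    by rewrite mulrBl mul1r opprB addrA subrK.
  apply: ideal_gen_D IH _; rewrite -mulrN; exact/ideal_gen_Mr/y_unit.
have := @mulr_mono j k a (enum J) (enum_uniq _) (mem_enum _ _).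
pose a' i := (if i == j then k + a j else a i)%N; set c' := _%:R;
  rewrite -/a' => Fj.
exists (c * c'), a'; rewrite /wdeg /wprod !big_cons /= -/(wdeg s) -/(wprod s);
  split.
  rewrite -deg_a (bigD1 j) // [in RHS](bigD1 j) //= /a' eqxx addnA;
    congr (_ + _)%N.
  by apply: eq_bigr => i /negbTE->.
rewrite big_enum deg_a in Fj.
have -> : y j k * wprod s - (c * c') *: mono a' (enum J) =
   y j k * (wprod s - c *: mono a (enum J)) +
   c *: (y j k * mono a (enum J) - c' *: mono a' (enum J)).
  by rewrite mulrBr scalerBr scalerA -scaleAr addrA subrK.
apply: span_mod_D; last exact: span_mod_Z.
by apply: Fil_Ml; first exact: Fil_y.
Qed.

(** Ordered monomials with exponents below q; all other ordered monomials are
0. *)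
Definition qmono (a : {ffun J -> 'I_q}) : A := mono (fun j => a j) (enum J).

(** Each word is a multiple of an ordered monomial modulo words of lower
degree. *)
Lemma Fil_qmono d f : Fil d f -> span_mod (fun g => exists a, g = qmono a) f.
Proof.
elim: d f => [|d IH] f; first by move/Fil_0/span_mod_ideal.
apply: span_mod_trans => g [s lt_s ->].
have [c [a [_ Fs]]] := wprod_mono s.
apply: span_mod_subr (IH _ (Fil_le _ Fs)) _ => //; apply: span_mod_Z.
have [/forallP lt_aq|] := boolP [forall j, a j < q]%N.
  apply: span_mod_in; exists [ffun j => Ordinal (lt_aq j)].
  by apply: eq_bigr => j _; rewrite ffunE.
rewrite negb_forall => /existsP[j]; rewrite -leqNgt => le_q.
suff -> : mono a (enum J) = 0 by apply: span_mod_0.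
have := mem_enum J j; rewrite /mono; elim: (enum J) => // i e IHe.
rewrite inE big_cons => /orP[/eqP <-|/IHe ->]; last by rewrite mulr0.
by rewrite y_big // mul0r.
Qed.
End Straightening.

(** * Ordered monomials span the presented algebra *)

Section MatrixUnits.
Context (n : nat) (K : fieldType) (p m : nat) (charK : p \in [pchar K]).
Local Notation q := (p ^ m)%N.
Local Notation F := {malg K[{fmonom gen n q}]}.
Local Notation I := (ideal_gen (@relator n K p m)).
Local Notation hsym := (@hsym n K p m).
Local Notation xsym := (@xsym n K p m).

(** The generators are indexed uniformly by the matrix units, the diagonal one
at (i, i) standing for the binomials of H_i. *)
Definition ysym (ij : 'I_n * 'I_n) (k : nat) : F :=
  if (insub ij : option (Phi n)) is Some al then xsym al k else hsym ij.1 k.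

Local Notation Fil := (Fil (@relator n K p m) ysym).

Let p_pr : prime p. Proof. by case/andP: charK. Qed.
Let q_gt0 : (0 < q)%N. Proof. by rewrite expn_gt0 prime_gt0. Qed.
Let ltq u : (u < m)%N -> (p ^ u < q)%N.
Proof. by move=> ?; rewrite ltn_exp2l // prime_gt1. Qed.

Lemma ysym_root (al : Phi n) k : ysym (val al) k = xsym al k.
Proof. by rewrite /ysym valK. Qed.

Lemma ysym_diag i k : ysym (i, i) k = hsym i k.
Proof. by rewrite /ysym insubN //= eqxx. Qed.

Lemma root_or_diag (P : 'I_n * 'I_n -> Prop) :
  (forall al : Phi n, P (val al)) -> (forall i, P (i, i)) -> forall ij, P ij.
Proof.
move=> Proot Pdiag [i j]; have [<-|ne] := eqVneq i j; first exact: Pdiag.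
exact: (Proot (Sub (i, j) ne)).
Qed.

Let scaleAr c (f g : F) : c *: (f * g) = f * (c *: g) := malg_scaleAr c f g.

Lemma hsym_Fil i k : Fil k.+1 (hsym i k).
Proof. by rewrite -ysym_diag; apply: Fil_y. Qed.

Lemma xsym_Fil al k : Fil k.+1 (xsym al k).
Proof. by rewrite -ysym_root; apply: Fil_y. Qed.

Lemma defrel_ideal f g : defrel f g -> I (f - g).
Proof. by move=> fg; apply: ideal_gen_in; exists f, g. Qed.

Lemma defrel_Fil d f g h : defrel f g -> Fil d (g - h) -> Fil d (f - h).
Proof.
move=> /defrel_ideal Ifg Fgh; rewrite -(subrKA g f).
by apply: span_mod_D Fgh; apply: span_mod_ideal.
Qed.

Lemma ysym_unit ij : I (ysym ij 0 - 1).
Proof.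
elim/root_or_diag: ij => [al|i]; [rewrite ysym_root|rewrite ysym_diag].
  exact/defrel_ideal/rel_b0.
exact/defrel_ideal/rel_h0.
Qed.

Lemma ysym_big ij k : (q <= k)%N -> ysym ij k = 0.
Proof.
rewrite leqNgt => /negP/negP nlt.
by elim/root_or_diag: ij => [al|i];
  rewrite ?ysym_root ?ysym_diag /Defs.hsym /Defs.xsym insubN.
Qed.

(** The sums on the right of the relations are of this kind: the term of index 0
is the leading one, and the others have lower degree. *)
Lemma Fil_sum_lead d N (f : nat -> F) h :
  Fil d (f 0 - h) -> (forall a, (0 < a < N.+1)%N -> Fil d (f a)) ->
  Fil d (\sum_(a < N.+1) f a - h).
Proof.
move=> F0 Ff; rewrite big_ord_recl addrAC; apply: span_mod_D => //.
by apply: span_mod_sum => i; apply: Ff => /=; rewrite ltnS.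
Qed.

Lemma binz0 z : binz z 0 = 1.
Proof. by case: z => k; rewrite /= ?bin0 ?mul1r. Qed.

Lemma hshift_Fil i z a : Fil a (hshift K p m i z a - hsym i a).
Proof.
rewrite /hshift big_ord_recr /= subnn binz0 scale1r addrK.
by apply: span_mod_sum => t; apply/span_mod_Z/(Fil_le _ (hsym_Fil _ _)).
Qed.

Lemma hneg_Fil i b : Fil b.+1 (hneg K p m i b).
Proof.
apply: span_mod_Z; apply: span_mod_subr (hsym_Fil i b).
exact/Fil_le/hshift_Fil.
Qed.

Lemma hroot_Fil al c a : Fil a.+1 (hroot K p m al c a).
Proof.
apply: span_mod_sum => -[t /= lt_t]; apply: span_mod_sum => -[s /= lt_s].
apply/span_mod_Z/(Fil_le _ (Fil_M scaleAr (hsym_Fil _ _) (hneg_Fil _ _))).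
by rewrite /=; lia.
Qed.

Lemma hroot0 al c : I (hroot K p m al c 0 - 1).
Proof.
rewrite /hroot big_ord1 big_ord1 /= /hneg expr0 scale1r /hshift big_ord1 /=.
rewrite !binz0 !scale1r; set h := hsym _ 0; set h' := hsym _ 0.
have -> : h * h' - 1 = h * (h' - 1) + (h - 1).
  by rewrite mulrBr mulr1 addrA subrK.
by apply: ideal_gen_D; first apply: ideal_gen_Ml; apply/defrel_ideal/rel_h0.
Qed.

Lemma ysym_merge ij k l : (k < q)%N -> (l < q)%N ->
  Fil (k + l) (ysym ij k * ysym ij l - 'C(k + l, k)%:R *: ysym ij (k + l)).
Proof.
move=> lt_k lt_l; elim/root_or_diag: ij => [al|i];
  rewrite ?ysym_root ?ysym_diag.
  exact/span_mod_ideal/defrel_ideal/rel_b.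
apply: defrel_Fil (rel_a K i lt_k lt_l) _.
apply: (@Fil_sum_lead _ _ (fun c =>
  ('C(k + l - c, k - c) * 'C(l, l - c))%:R *: hsym i (k + l - c))).
  by rewrite !subn0 binn muln1 subrr; apply: span_mod_0.
move=> c lt_c; apply/span_mod_Z/(Fil_le _ (hsym_Fil _ _)).
lia.
Qed.

Lemma root_comm (al be : Phi n) u v : (u < m)%N -> (v < m)%N ->
  Fil (p ^ u + p ^ v)
    (xsym al (p ^ u) * xsym be (p ^ v) - xsym be (p ^ v) * xsym al (p ^ u)).
Proof.
move=> lt_u lt_v.
have bracket ga : rvec al + rvec be = rvec ga ->
  Fil (p ^ u + p ^ v)
    (xsym al (p ^ u) * xsym be (p ^ v) - xsym be (p ^ v) * xsym al (p ^ u)).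
  move=> /(rel_d K p lt_u lt_v)/defrel_Fil; apply.
  apply: (@Fil_sum_lead _ _ (fun a => (cst al be ^+ a)%:~R *:
           (xsym be (p ^ v - a) * xsym ga a * xsym al (p ^ u - a)))).
    rewrite !subn0 expr0 scale1r -mulrBl -[X in (_ - X) * _]mulr1 -mulrBr.
    by apply/span_mod_ideal/ideal_gen_Mr/ideal_gen_Ml/defrel_ideal/rel_b0.
  move=> a /andP[a_gt0]; rewrite ltnS leq_min => /andP[le_au le_av].
  apply/span_mod_Z/(Fil_le _ (Fil_M scaleAr (Fil_M scaleAr _ _) _));
    last 3 first.
  - exact: xsym_Fil.
  - exact: xsym_Fil.
  - exact: xsym_Fil.
  by rewrite /=; lia.
have [jk|jk] := eqVneq (tgt al) (src be);
  have [il|il] := eqVneq (src al) (tgt be).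
- have -> : be = ropp al by apply: val_inj;
    rewrite [RHS]/= jk il -surjective_pairing.
  apply: defrel_Fil (rel_e K p al lt_u lt_v) _.
  apply: (@Fil_sum_lead _ _ (fun a => xsym (ropp al) (p ^ v - a)
         * hroot K p m al (- (p ^ u)%N%:Z - (p ^ v)%N%:Z + (2 * a)%N%:Z) a
         * xsym al (p ^ u - a))).
    rewrite !subn0 -mulrBl -[X in (_ - X) * _]mulr1 -mulrBr.
    by apply/span_mod_ideal/ideal_gen_Mr/ideal_gen_Ml/hroot0.
  move=> a /andP[a_gt0]; rewrite ltnS leq_min => /andP[le_au le_av].
  apply: (Fil_le _ (Fil_M scaleAr (Fil_M scaleAr _ _) _)); last 3 first.
  - exact: xsym_Fil.
  - exact: hroot_Fil.
  - exact: xsym_Fil.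
  by rewrite /=; lia.
- apply: (bracket (Sub (src al, tgt be) il)).
  by rewrite /rvec /src /tgt /= -/(tgt al) -/(src be) jk addrA subrK.
- rewrite eq_sym in jk; apply: (bracket (Sub (src be, tgt al) jk)).
  by rewrite /rvec /src /tgt /= -/(tgt be) -/(src al) il addrC addrA subrK.
apply/span_mod_ideal/defrel_ideal/rel_f => // [/rowP/(_ (src al))|ga].
  rewrite mxE [RHS]mxE !rvecE eqxx ![_ == src al]eq_sym (negbTE il).
  by rewrite (negbTE (valP al)); case: (_ == _).
by move=> /rvec_add_root [] [/eqP]; rewrite ?(negbTE jk) ?(negbTE il).
Qed.

Lemma H_root_comm i (al : Phi n) u v : (u < m)%N -> (v < m)%N ->
  Fil (p ^ v + p ^ u)
    (hsym i (p ^ v) * xsym al (p ^ u) - xsym al (p ^ u) * hsym i (p ^ v)).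
Proof.
move=> lt_u lt_v.
have shift z : Fil (p ^ v + p ^ u)
    (xsym al (p ^ u) * hshift K p m i z (p ^ v)
     - xsym al (p ^ u) * hsym i (p ^ v)).
  rewrite -mulrBr addnC; apply: Fil_Ml => //;
    [exact: xsym_Fil|exact: hshift_Fil].
have [i_s|ne_s] := eqVneq i (src al).
  by move: (shift (p ^ u)%N%:Z); rewrite i_s; apply/defrel_Fil/rel_g_src.
have [i_t|ne_t] := eqVneq i (tgt al).
  by move: (shift (- (p ^ u)%N%:Z)); rewrite i_t; apply/defrel_Fil/rel_g_tgt.
by apply/span_mod_ideal/defrel_ideal/rel_g_other.
Qed.

Lemma ysym_comm_pow ij kl u v : (u < m)%N -> (v < m)%N ->
  Fil (p ^ u + p ^ v)
    (ysym ij (p ^ u) * ysym kl (p ^ v) - ysym kl (p ^ v) * ysym ij (p ^ u)).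
Proof.
move=> lt_u lt_v; elim/root_or_diag: ij => [al|i];
  elim/root_or_diag: kl => [be|k];
  rewrite ?ysym_root ?ysym_diag.
- exact: root_comm.
- by rewrite addnC -opprB; apply/span_mod_N/H_root_comm.
- exact: H_root_comm.
exact/span_mod_ideal/defrel_ideal/rel_c.
Qed.

Lemma malg_span (f : F) : span_mod (@relator n K p m)
  (fun g => exists a : {ffun 'I_n * 'I_n -> 'I_q}, g = qmono ysym a) f.
Proof.
elim/malg_word_ind: f => [|f g|c f|s].
- exact: span_mod_0.
- exact: span_mod_D.
- exact: span_mod_Z.
suff [d] : exists d, Fil d.+1 (word K s).
  apply: Fil_qmono => //; first exact: ysym_unit.
  - exact: ysym_big.
  - exact: ysym_merge.
  exact: ysym_comm_pow.
elim: s => [|x s [d IH]]; first by exists 0%N; rewrite /word big_nil;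
  apply: Fil_1.
have [k Fx] : exists k, Fil k.+1 (<< fmu x >> : F).
  case: x => -[i k]; exists k; [have := hsym_Fil i k|have := xsym_Fil i k].
    by rewrite /Defs.hsym valK.
  by rewrite /Defs.xsym valK.
exists (k + d)%N; rewrite /word big_cons -addnS; exact: Fil_Ml.
Qed.
End MatrixUnits.

(** * The algebra of linear endomorphisms *)

Section LinearEndo.
Context (R : comNzRingType) (V : lalgType R).

(** The universal property of the enveloping algebra will be applied to the
linear endomorphisms of a polynomial ring, a space of infinite dimension: hence
functions under composition, and not matrices. *)
Record lendo := Lendo { lendo_fun :> V -> V; lendo_linear : linear lendo_fun }.

HB.instance Definition _ := boolp.gen_eqMixin lendo.
HB.instance Definition _ := boolp.gen_choiceMixin lendo.
HB.instance Definition _ (f : lendo) :=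
  GRing.isLinear.Build R V V *:%R (lendo_fun f) (lendo_linear f).

Implicit Types f g h : lendo.

Lemma lendoP f g : f =1 g -> f = g.
Proof.
case: f g => f Lf [g Lg] /= /boolp.funext fg; rewrite fg in Lf *.
by rewrite (boolp.Prop_irrelevance Lf Lg).
Qed.

Fact lendo_zero_linear : linear (fun _ : V => 0 : V).
Proof. by move=> c x y; rewrite scaler0 addr0. Qed.
Definition lendo_zero := Lendo lendo_zero_linear.

Fact lendo_opp_linear f : linear (fun x => - f x).
Proof. by move=> c x y; rewrite linearP opprD scalerN. Qed.
Definition lendo_opp f := Lendo (lendo_opp_linear f).

Fact lendo_add_linear f g : linear (fun x => f x + g x).
Proof. by move=> c x y; rewrite !linearP scalerDr addrACA. Qed.
Definition lendo_add f g := Lendo (lendo_add_linear f g).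

Fact lendo_one_linear : linear (fun x : V => x).
Proof. by []. Qed.
Definition lendo_one := Lendo lendo_one_linear.

Fact lendo_mul_linear f g : linear (fun x => f (g x)).
Proof. by move=> c x y; rewrite !linearP. Qed.
Definition lendo_mul f g := Lendo (lendo_mul_linear f g).

Fact lendo_scale_linear (a : R) f : linear (fun x => a *: f x).
Proof. by move=> c x y; rewrite linearP scalerDr !scalerA mulrC. Qed.
Definition lendo_scale a f := Lendo (lendo_scale_linear a f).

Fact lendo_addA : associative lendo_add.
Proof. by move=> f g h; apply: lendoP => x /=; rewrite addrA. Qed.
Fact lendo_addC : commutative lendo_add.
Proof. by move=> f g; apply: lendoP => x /=; rewrite addrC. Qed.
Fact lendo_add0 : left_id lendo_zero lendo_add.
Proof. by move=> f; apply: lendoP => x /=; rewrite add0r. Qed.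
Fact lendo_addN : left_inverse lendo_zero lendo_opp lendo_add.
Proof. by move=> f; apply: lendoP => x /=; rewrite addNr. Qed.
HB.instance Definition _ :=
  GRing.isZmodule.Build lendo lendo_addA lendo_addC lendo_add0 lendo_addN.

Fact lendo_mulA : associative lendo_mul.
Proof. by move=> f g h; apply: lendoP. Qed.
Fact lendo_mul1 : left_id lendo_one lendo_mul.
Proof. by move=> f; apply: lendoP. Qed.
Fact lendo_mulr1 : right_id lendo_one lendo_mul.
Proof. by move=> f; apply: lendoP. Qed.
Fact lendo_mulDl : left_distributive lendo_mul lendo_add.
Proof. by move=> f g h; apply: lendoP. Qed.
Fact lendo_mulDr : right_distributive lendo_mul lendo_add.
Proof. by move=> f g h; apply: lendoP => x /=; rewrite linearD. Qed.
Fact lendo_1neq0 : lendo_one != 0.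
Proof.
apply/eqP => /(congr1 (fun f : lendo => f 1)) /= /eqP.
by rewrite (negbTE (oner_neq0 V)).
Qed.
HB.instance Definition _ := GRing.Zmodule_isNzRing.Build lendo
  lendo_mulA lendo_mul1 lendo_mulr1 lendo_mulDl lendo_mulDr lendo_1neq0.

Fact lendo_scaleA a b f :
  lendo_scale a (lendo_scale b f) = lendo_scale (a * b) f.
Proof. by apply: lendoP => x /=; rewrite scalerA. Qed.
Fact lendo_scale1 : left_id 1 lendo_scale.
Proof. by move=> f; apply: lendoP => x /=; rewrite scale1r. Qed.
Fact lendo_scaleDr : right_distributive lendo_scale +%R.
Proof. by move=> a f g; apply: lendoP => x /=; rewrite scalerDr. Qed.
Fact lendo_scaleDl f : {morph lendo_scale^~ f : a b / a + b}.
Proof. by move=> a b; apply: lendoP => x /=; rewrite scalerDl. Qed.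
HB.instance Definition _ := GRing.Zmodule_isLmodule.Build R lendo
  lendo_scaleA lendo_scale1 lendo_scaleDr lendo_scaleDl.

Fact lendo_scaleAl (a : R) (f g : lendo) : a *: (f * g) = (a *: f) * g.
Proof. exact: lendoP. Qed.
HB.instance Definition _ :=
  GRing.Lmodule_isLalgebra.Build R lendo lendo_scaleAl.

Fact lendo_scaleAr (a : R) (f g : lendo) : a *: (f * g) = f * (a *: g).
Proof. by apply: lendoP => x /=; rewrite linearZ. Qed.
HB.instance Definition _ :=
  GRing.Lalgebra_isAlgebra.Build R lendo lendo_scaleAr.
End LinearEndo.

(** * Divided powers of derivations *)

Section Derivation.
Context (S : comAlgType rat).
Implicit Types (f g w : S) (d : S -> S).

Definition derivation d := forall f g, d (f * g) = d f * g + f * d g.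

Lemma derivation1 d : derivation d -> d 1 = 0.
Proof.
by move=> dM; apply: (addrI (d 1));
  rewrite addr0 -{3}[1](mulr1 1) dM mulr1 mul1r.
Qed.

Lemma derivation_bracket (d d' : {linear S -> S}) :
  derivation d -> derivation d' ->
  derivation (fun f => d (d' f) - d' (d f)).
Proof. by move=> dM dM' f g; rewrite dM' dM !raddfD /= !dM !dM'; ring. Qed.

(** For c = 0 the maps P k are the divided powers of d, and for c = 1 the
binomials in d; these are the two kinds of generators of the Kostant form. *)
Definition divided_seq (d : {linear S -> S}) (c : nat) (P : nat -> S -> S) :=
  (forall f, P 0 f = f) /\
  forall k f, P k.+1 f *+ k.+1 = d (P k f) - P k f *+ (c * k).

(** The Leibniz rule for P k reduces to two terms when d w is an eigenvector of
d with eigenvalue c, since then P i w = 0 for i > 1. *)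
Lemma divided_seqM (d : {linear S -> S}) c P w f k :
  derivation d -> divided_seq d c P ->
  d (d w) = d w *+ c ->
  P k.+1 (w * f) = w * P k.+1 f + d w * P k f.
Proof.
move=> dM [P0 PS] ddw; elim: k => [|k IH].
  have P1 g : P 1 g = d g.
    by have := PS 0 g; rewrite P0 muln0 mulr0n subr0.
  by rewrite !P1 dM P0 addrC.
apply: (@mulrSn_inj _ k.+1); rewrite mulrnDl -[X in _ = X + _]mulrnAr !PS IH.
rewrite raddfD /= !dM ddw !mulrnDl.
have -> : d w * P k.+1 f *+ k.+2 = d w * P k.+1 f + d w * (P k.+1 f *+ k.+1).
  by rewrite mulrnAr -mulrS.
rewrite PS; ring.
Qed.

Lemma divided_seq1 (d : {linear S -> S}) c P k :
  derivation d -> divided_seq d c P -> P k 1 = (k == 0)%:R.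
Proof.
move=> dM [P0 PS]; have d1 := derivation1 dM.
elim: k => [|k IH]; first exact: P0.
apply: (@mulrSn_inj _ k); rewrite PS IH mul0rn; case: k {IH} => [|k] /=.
  by rewrite muln0 d1 mulr0n subr0.
by rewrite raddf0 mul0rn subr0.
Qed.
End Derivation.

Section VanishingOrder.
Context (J : eqType) (S : comAlgType rat) (y : J -> S).
Implicit Types (f g : S) (j : J) (r : nat).

(** The ideal of the functions vanishing to order r at the point y = 0, that is
the r-th power of the ideal generated by the y j. *)
Inductive vanish : nat -> S -> Prop :=
| vanish_any f : vanish 0 f
| vanish_0 r : vanish r 0
| vanish_M r j f : vanish r f -> vanish r.+1 (y j * f)
| vanish_D r f g : vanish r f -> vanish r g -> vanish r (f + g).

Lemma vanishMl r f g : vanish r f -> vanish r (g * f).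
Proof.
elim=> {r f} [f|r|r j f _ IH|r f f' _ IH _ IH'].
- exact: vanish_any.
- by rewrite mulr0; apply: vanish_0.
- by rewrite mulrCA; apply: vanish_M.
by rewrite mulrDr; apply: vanish_D.
Qed.

Lemma vanish_le r r' f : (r' <= r)%N -> vanish r f -> vanish r' f.
Proof.
move=> le_r Vf;
  elim: Vf r' le_r => {r f} [f|r|r j f _ IH|r f g _ IHf _ IHg] [|r'] //= le_r.
all: try exact: vanish_any.
- exact: vanish_0.
- exact/vanish_M/IH.
exact: vanish_D (IHf _ le_r) (IHg _ le_r).
Qed.

Lemma vanish_y j : vanish 1 (y j).
Proof. by rewrite -[y j]mulr1; apply/vanish_M/vanish_any. Qed.

Lemma vanishM r s f g : vanish r f -> vanish s g -> vanish (r + s) (f * g).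
Proof.
move=> + Vg; elim=> {r f} [f|r|r j f _ IH|r f f' _ IH _ IH'].
- exact: vanishMl.
- by rewrite mul0r; apply: vanish_0.
- by rewrite -mulrA addSn; apply: vanish_M.
by rewrite mulrDl; apply: vanish_D.
Qed.

Definition ymon (w : seq J) : S := \prod_(j <- w) y j.

Lemma vanish_ymon w : vanish (size w) (ymon w).
Proof.
elim: w => [|j w IH]; first exact: vanish_any.
by rewrite /ymon big_cons; apply: vanish_M.
Qed.

(** The subring generated by the y j, in the form best suited to the two-term
Leibniz rule. *)
Inductive integral_span : S -> Prop :=
| integral_span_1 : integral_span 1
| integral_span_y j f : integral_span f -> integral_span (y j * f)
| integral_span_B f g :
  integral_span f -> integral_span g -> integral_span (f - g).

Lemma integral_span_0 : integral_span 0.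
Proof. by rewrite -(subrr 1); apply: integral_span_B;
  apply: integral_span_1. Qed.

Lemma integral_span_D f g :
  integral_span f -> integral_span g -> integral_span (f + g).
Proof.
move=> Lf Lg; rewrite -[g]opprK; apply: integral_span_B => //.
by rewrite -sub0r; apply: integral_span_B => //; apply: integral_span_0.
Qed.

Lemma integral_ymon w : integral_span (ymon w).
Proof.
elim: w => [|j w IH]; first by rewrite /ymon big_nil; apply: integral_span_1.
by rewrite /ymon big_cons; apply: integral_span_y.
Qed.

Lemma integral_eps (eps : {rmorphism S -> rat}) f :
  (forall j, eps (y j) = 0) -> integral_span f -> exists z : int, eps f = z%:~R.
Proof.
move=> eps_y; elim=> {f} [|j f _ _|f g _ [a fa] _ [b gb]].
- by exists 1; rewrite rmorph1.
- by exists 0; rewrite rmorphM eps_y mul0r.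
by exists (a - b); rewrite rmorphB intrB fa gb.
Qed.

Lemma eps_vanish (eps : {rmorphism S -> rat}) f :
  (forall j, eps (y j) = 0) -> vanish 1 f -> eps f = 0.
Proof.
move=> eps_y; move: {-2}1%N (erefl 1%N) => r eq_r Vf.
elim: Vf eq_r => {r f} [//|r _|r j f _ _ _|r f g _ IHf _ IHg eq_r].
- exact: rmorph0.
- by rewrite rmorphM eps_y mul0r.
by rewrite rmorphD IHf // IHg // addr0.
Qed.

End VanishingOrder.

(** Abstractly, d i is a vector field on the affine space with coordinates y j
whose value at the origin is the i-th coordinate vector, and pd i is the
constant field with that value; P i and Q i are the associated sequences of
operators. *)
Section LeadingTerm.
Context (J : eqType) (S : comAlgType rat) (y : J -> S).
Context (d pd : J -> {linear S -> S}) (c : J -> nat).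
Context (P Q : J -> nat -> {linear S -> S}).
Context (eps : {rmorphism S -> rat}).
Implicit Types (f g : S) (i j : J) (k r : nat) (a : J -> nat) (e w : seq J).
Hypothesis eps_y : forall j, eps (y j) = 0.
Hypothesis d_der : forall j, derivation (d j).
Hypothesis pd_der : forall j, derivation (pd j).
Hypothesis P_div : forall j, divided_seq (d j) (c j) (P j).
Hypothesis Q_div : forall j, divided_seq (pd j) 0 (Q j).
Hypothesis pd_y : forall i j, pd i (y j) = (i == j)%:R.
Hypothesis d_y : forall i j, vanish y 1 (d i (y j) - pd i (y j)).
Hypothesis dd_y : forall i j, d i (d i (y j)) = d i (y j) *+ c i.

Local Notation V := (vanish y).

Lemma P_0 i f : P i 0 f = f. Proof. exact: (P_div i).1. Qed.
Lemma Q_0 i f : Q i 0 f = f. Proof. exact: (Q_div i).1. Qed.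

Lemma P_y i j k f : P i k.+1 (y j * f) = y j * P i k.+1 f + d i (y j) * P i k f.
Proof. exact: divided_seqM (d_der i) (P_div i) (dd_y i j). Qed.

Lemma Q_y i j k f :
  Q i k.+1 (y j * f) = y j * Q i k.+1 f + (Q i k f *+ (i == j)).
Proof.
rewrite (divided_seqM _ _ (pd_der i) (Q_div i)) pd_y;
  first by rewrite mulr_natl.
by rewrite mulr0n; case: (i == j); rewrite ?derivation1 ?raddf0.
Qed.

Lemma Q_1 i k : Q i k 1 = (k == 0)%:R.
Proof. exact: divided_seq1 (pd_der i) (Q_div i). Qed.

Lemma vanish_Q i k r f : V r f -> V (r - k) (Q i k f).
Proof.
move=> Vf; elim: Vf k => {r f} [f|r|r j f Vf IH|r f g _ IHf _ IHg] k.
- exact: vanish_any.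
- by rewrite raddf0; apply: vanish_0.
- case: k => [|k]; first by rewrite Q_0 subn0; apply: vanish_M.
  rewrite Q_y subSS; apply: vanish_D.
    by apply: vanish_le (vanish_M _ (IH k.+1)); lia.
  by case: (i == j); rewrite ?mulr0n; [apply: IH|apply: vanish_0].
by rewrite raddfD; apply: vanish_D.
Qed.

(** As d i and pd i agree at the origin, P i k and Q i k, which both lower the
order of vanishing by k, differ by an operator which lowers it by k - 1 only. *)
Lemma vanish_PQ i k r f : V r f -> V (r.+1 - k) (P i k f - Q i k f).
Proof.
move=> Vf; elim: Vf k => {r f} [f|r|r j f Vf IH|r f g _ IHf _ IHg] k.
- case: k => [|k]; last by rewrite subSS sub0n; apply: vanish_any.
  by rewrite P_0 Q_0 subrr; apply: vanish_0.
- by rewrite !raddf0 ?subr0 ?addr0; apply: vanish_0.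
- case: k => [|k].
    by rewrite P_0 Q_0 subrr; apply: vanish_0.
  have VP : V (r - k) (P i k f).
    rewrite -(subrK (Q i k f) (P i k f)); apply: vanish_D; last exact: vanish_Q.
    by apply: vanish_le (IH k); lia.
  rewrite P_y Q_y -mulr_natl -pd_y subSS.
  have -> : y j * P i k.+1 f + d i (y j) * P i k f
            - (y j * Q i k.+1 f + pd i (y j) * Q i k f) =
    y j * (P i k.+1 f - Q i k.+1 f) + (d i (y j) - pd i (y j)) * P i k f
    + pd i (y j) * (P i k f - Q i k f) by ring.
  apply: vanish_D; last exact/vanishMl/IH.
  apply: vanish_D.
    by apply: vanish_le (vanish_M _ (IH k.+1)); lia.
  by apply: vanish_le (vanishM (d_y i j) VP); lia.
by rewrite !raddfD addrACA; apply: vanish_D.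
Qed.

Lemma vanish_P i k r f : V r f -> V (r - k) (P i k f).
Proof.
move=> Vf; rewrite -(subrK (Q i k f) (P i k f)); apply: vanish_D;
  last exact: vanish_Q.
by apply: vanish_le (vanish_PQ i k Vf); lia.
Qed.

Definition compose (T : J -> nat -> {linear S -> S}) a e f :=
  foldr (fun j g => T j (a j) g) f e.

Lemma vanish_compose_P a e r f :
  V r f -> V (r - \sum_(j <- e) a j) (compose P a e f).
Proof.
move=> Vf; elim: e => [|j e IH] /=; first by rewrite big_nil subn0.
by rewrite big_cons addnC subnDA; apply: vanish_P.
Qed.

Lemma vanish_compose_PQ a e r f : V r f ->
  V (r.+1 - \sum_(j <- e) a j) (compose P a e f - compose Q a e f).
Proof.
move=> Vf; elim: e => [|j e IH] /=; first by rewrite subrr; apply: vanish_0.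
rewrite big_cons; set g := compose P a e f; set h := compose Q a e f.
rewrite -(subrKA (Q j (a j) g)) -raddfB; apply: vanish_D.
  by apply: vanish_le (vanish_PQ j (a j) (vanish_compose_P a e Vf)); lia.
by apply: vanish_le (vanish_Q j (a j) IH); lia.
Qed.

Lemma compose_Q_notin a b e j f :
  j \notin e -> (forall i, i != j -> a i = b i) ->
  compose Q a e f = compose Q b e f.
Proof.
move=> + ab; elim: e => //= i e IH; rewrite inE negb_or => /andP[ne_ij j_e].
by rewrite IH // ab // eq_sym.
Qed.

Lemma compose_Q_y_notin a e j f : j \notin e ->
  compose Q a e (y j * f) = y j * compose Q a e f.
Proof.
elim: e => //= i e IH; rewrite inE negb_or => /andP[ne_ij j_e].
rewrite IH //; case: (a i) => [|k]; first by rewrite !Q_0.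
by rewrite Q_y eq_sym (negbTE ne_ij) mulr0n addr0.
Qed.

(** Partial derivatives commute with every coordinate but their own. *)
Lemma compose_Q_y a e j f : uniq e -> j \in e ->
  compose Q a e (y j * f) = y j * compose Q a e f +
    (if a j is k.+1 then compose Q (fun i =>
      if i == j then k else a i) e f else 0).
Proof.
elim: e => //= i e IH /andP[+ e_uniq]; rewrite inE.
have [<- j_e _|ne_ji _ /= j_e] := eqVneq j i.
  rewrite compose_Q_y_notin //; case: (a j) => [|k] /=.
    by rewrite !Q_0 addr0.
  rewrite Q_y !eqxx mulr1n; congr (_ + Q j k _); apply: (compose_Q_notin _ j_e).
  by move=> i' /negbTE->.
rewrite IH // raddfD /=; congr (_ + _).
  case: (a i) => [|k]; first by rewrite !Q_0.
  by rewrite Q_y eq_sym (negbTE ne_ji) mulr0n addr0.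
case: (a j) => [|k]; first exact: raddf0.
by [].
Qed.

(** At the origin, multiplication by y j is dual to lowering the j-th
exponent. *)
Lemma eps_compose_Q a e w : uniq e -> {subset w <= e} ->
  eps (compose Q a e (ymon y w)) = (all (fun j => a j == count_mem j w) e)%:R.
Proof.
move=> e_uniq; elim: w a => [|j w IH] a w_e.
  rewrite /ymon big_nil -(rmorph_nat eps); congr (eps _).
  elim: e {e_uniq w_e} => //= i e ->; rewrite eqn0Ngt.
  case: (all _ _); rewrite ?andbT ?andbF ?raddf0 //.
  by rewrite Q_1 lt0n negbK.
rewrite /ymon big_cons compose_Q_y ?w_e ?mem_head //
  rmorphD rmorphM eps_y mul0r add0r.
case aj : (a j) => [|k].
  rewrite rmorph0; case: allP => // /(_ j (w_e _ (mem_head _ _))) /=.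
  by rewrite aj eqxx.
rewrite IH => [|i i_w]; last by apply: w_e; rewrite inE i_w orbT.
congr (nat_of_bool _)%:R; apply: eq_all => i /=; rewrite [j == i]eq_sym.
by case: (i =P j) => [->|_]; rewrite ?add0n // aj eqSS.
Qed.

(** The error made when replacing P by Q vanishes at the origin, because the
monomial vanishes there to at least the order removed by the operators. *)
Lemma eps_compose_P a e w : uniq e -> {subset w <= e} ->
  (\sum_(j <- e) a j <= size w)%N ->
  eps (compose P a e (ymon y w)) = (all (fun j => a j == count_mem j w) e)%:R.
Proof.
move=> e_uniq w_e le_a; rewrite -eps_compose_Q //.
apply/eqP; rewrite -subr_eq0 -rmorphB; apply/eqP/(eps_vanish eps_y).
by apply: vanish_le (vanish_compose_PQ a e (vanish_ymon y w)); lia.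
Qed.

Hypothesis d_y_int :
  forall i j f, integral_span y f -> integral_span y (d i (y j) * f).

Lemma integral_P i k f : integral_span y f -> integral_span y (P i k f).
Proof.
move=> Lf; elim: Lf k => {f} [|j f _ IH|f g _ IHf _ IHg] k.
- rewrite (divided_seq1 _ (d_der i) (P_div i)).
  by case: (k == 0%N); [apply: integral_span_1|apply: integral_span_0].
- case: k => [|k]; first by rewrite P_0; apply: integral_span_y;
    rewrite -[f](P_0 i).
  rewrite P_y; apply: integral_span_D; [exact: integral_span_y|exact: d_y_int].
by rewrite raddfB; apply: integral_span_B; [exact: IHf|exact: IHg].
Qed.
End LeadingTerm.

(** * Right multiplication on the generic matrix *)

(** The polynomial ring in the entries of an n x n matrix y. *)
Module Coordinates.
Import mpoly.
Section Coordinates.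
Context (n : nat).
Local Notation J := ('I_n * 'I_n)%type.
Definition S : comAlgType rat := {mpoly rat[#|{: J}|]}.
Definition y (j : J) : S := 'X_(enum_rank j).
Definition pd (j : J) : S -> S := mderiv (enum_rank j).
Definition eps : S -> rat := meval (fun _ => 0).

Fact pd_linear j : linear (pd j).
Proof. by move=> c f g; rewrite /pd linearP. Qed.

Fact eps_additive : additive eps.
Proof. by move=> f g; rewrite /eps raddfB. Qed.

Fact eps_multiplicative : multiplicative eps.
Proof. by split=> [f g|]; rewrite /eps ?rmorphM ?rmorph1. Qed.

Lemma pd_der j : derivation (pd j).
Proof. by move=> f g; rewrite /pd /= mderivM. Qed.

Lemma pd_y i j : pd i (y j) = (i == j)%:R.
Proof.
rewrite /pd /y /= mderivX mnm1E (inj_eq enum_rank_inj) eq_sym.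
case: eqP => [->|_]; last by rewrite scale0r.
by rewrite scale1r -[X in mnm_sub X _]add0m addmK mpolyX0.
Qed.

Lemma eps_y j : eps (y j) = 0.
Proof. by rewrite /eps /y /= mevalXU. Qed.

Lemma S_ind (Pr : S -> Prop) : Pr 1 -> (forall c f, Pr f -> Pr (c *: f)) ->
  (forall f g, Pr f -> Pr g -> Pr (f + g)) ->
  (forall j f, Pr f -> Pr (y j * f)) -> forall f, Pr f.
Proof.
move=> P1 PZ PD PM f; rewrite [f]mpolyE.
elim/big_rec: _ => [|w g _ Pg]; first by rewrite -(scale0r 1); apply: PZ.
apply: PD Pg; apply: PZ; rewrite mpolyXE_id.
elim/big_rec: _ => // i h _; elim: (w i) => [|k IH] Pg; first by rewrite mul1r.
have yE : 'X_i = y (enum_val i) by rewrite /y enum_valK.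
by rewrite exprS -mulrA yE; apply: PM; rewrite -yE; apply: IH.
Qed.
End Coordinates.
End Coordinates.

HB.instance Definition _ n j :=
  GRing.isLinear.Build rat (Coordinates.S n) (Coordinates.S n) *:%R
    (@Coordinates.pd n j) (@Coordinates.pd_linear n j).
HB.instance Definition _ n :=
  GRing.isAdditive.Build (Coordinates.S n) rat (@Coordinates.eps n)
    (@Coordinates.eps_additive n).
HB.instance Definition _ n :=
  GRing.isMultiplicative.Build (Coordinates.S n) rat (@Coordinates.eps n)
    (@Coordinates.eps_multiplicative n).
Arguments Coordinates.S : simpl never.
Arguments Coordinates.pd : simpl never.
Arguments Coordinates.y : simpl never.
Arguments Coordinates.eps : simpl never.

Section RightMultiplication.
Context (n : nat).
Local Notation J := ('I_n * 'I_n)%type.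
Local Notation S := (Coordinates.S n).
Local Notation y := (@Coordinates.y n).
Local Notation pd := (@Coordinates.pd n).
Implicit Types (Z W : 'M[rat]_n) (f g : S) (i j b : J).

(** The entries of the generic matrix X = 1 + y. *)
Definition xcoord (a k : 'I_n) : S := (a == k)%:R + y (a, k).

(** The entry b of X Z. *)
Definition vcoef Z b : S := \sum_k Z k b.2 *: xcoord b.1 k.

(** The derivation with value X Z on X: the infinitesimal right multiplication
by 1 + t Z. *)
Definition vfield Z f : S := \sum_b vcoef Z b * pd b f.

Fact vfield_linear Z : linear (vfield Z).
Proof.
move=> c f g; rewrite /vfield scaler_sumr -big_split; apply: eq_bigr => b _.
by rewrite linearP mulrDr scalerAr.
Qed.
HB.instance Definition _ Z :=
  GRing.isLinear.Build rat S S *:%R (vfield Z) (vfield_linear Z).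

Lemma vfield_der Z : derivation (vfield Z).
Proof.
move=> f g; rewrite /vfield mulr_suml mulr_sumr -big_split;
  apply: eq_bigr => b _.
by rewrite Coordinates.pd_der mulrDr mulrA [in RHS]mulrCA.
Qed.

Lemma vfield_y Z b : vfield Z (y b) = vcoef Z b.
Proof.
transitivity (vcoef Z b * pd b (y b)
              + \sum_(i | i != b) vcoef Z i * pd i (y b)).
  exact: bigD1.
rewrite Coordinates.pd_y eqxx mulr1 big1 ?addr0 // => i ne_ib.
by rewrite Coordinates.pd_y (negbTE ne_ib) mulr0.
Qed.

Lemma der_ext (d d' : {linear S -> S}) : derivation d -> derivation d' ->
  (forall b, d (y b) = d' (y b)) -> d =1 d'.
Proof.
move=> dM dM' dy; elim/Coordinates.S_ind => [|c f IH|f g IHf IHg|j f IH].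
- by rewrite !derivation1.
- by rewrite !linearZ IH.
- by rewrite !linearD IHf IHg.
by rewrite dM dM' dy IH.
Qed.

Lemma vfield_xcoord Z a k : vfield Z (xcoord a k) = vcoef Z (a, k).
Proof.
rewrite /xcoord raddfD /= vfield_y.
by case: (a == k); rewrite ?raddf0 ?(derivation1 (vfield_der Z)) add0r.
Qed.

Lemma vcoef_linear b c Z W : vcoef (c *: Z + W) b = c *: vcoef Z b + vcoef W b.
Proof.
rewrite /vcoef scaler_sumr -big_split; apply: eq_bigr => k _.
by rewrite !mxE scalerDl scalerA.
Qed.

Lemma vfield_vcoef Z W b : vfield Z (vcoef W b) = vcoef (Z *m W) b.
Proof.
rewrite /vcoef linear_sum;
  under eq_bigr => k _ do rewrite linearZ /= vfield_xcoord scaler_sumr.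
rewrite exchange_big; apply: eq_bigr => k _; rewrite mxE scaler_suml.
by apply: eq_bigr => l _; rewrite scalerA mulrC.
Qed.

Definition rmul_rep Z : lendo S := Lendo (vfield_linear Z).

Fact rmul_rep_linear : linear rmul_rep.
Proof.
move=> c Z W; apply: lendoP => f /=; rewrite /vfield scaler_sumr -big_split.
by apply: eq_bigr => b _; rewrite vcoef_linear mulrDl scalerAl.
Qed.
HB.instance Definition _ :=
  GRing.isLinear.Build rat 'M[rat]_n (lendo S) *:%R rmul_rep rmul_rep_linear.

(** Both sides are derivations, so it suffices to compare them on the
coordinates, where [Z, W] X = X (Z W - W Z). *)
Lemma rmul_rep_lie : lie_morphism rmul_rep.
Proof.
move=> Z W; apply: lendoP;
  pose r := rmul_rep Z * rmul_rep W - rmul_rep W * rmul_rep Z.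
apply: (@der_ext (vfield (Z *m W - W *m Z)) (lendo_fun r)).
- exact: vfield_der.
- exact: derivation_bracket (vfield_der Z) (vfield_der W).
move=> b; rewrite -[LHS]/(vfield _ (y b)).
rewrite -[RHS]/(vfield Z (vfield W (y b)) - vfield W (vfield Z (y b))).
rewrite !vfield_y !vfield_vcoef; have := vcoef_linear b (-1) (W *m Z) (Z *m W).
by rewrite !scaleN1r [- (W *m Z) + _]addrC => ->; rewrite addrC.
Qed.

(** The assumptions of the leading term analysis on the field of a matrix unit:
its value at the origin, the eigenvalue equation on coordinates (0 off the
diagonal, 1 on it) and integrality. *)
Section InvariantVectorField.
Context (ij : J).
Local Notation i := ij.1.
Local Notation j := ij.2.

Lemma vcoef_delta b : vcoef (delta_mx i j) b = (j == b.2)%:R * xcoord b.1 i.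
Proof.
rewrite /vcoef (bigD1 i) // -[LHS]/(_ + _) big1 => [|k ne_ki].
  by rewrite addr0 mxE eqxx andTb [b.2 == _]eq_sym scaler_nat mulr_natl.
by rewrite mxE (negbTE ne_ki) scale0r.
Qed.

Lemma vfield_delta_vanish b :
  vanish y 1 (vfield (delta_mx i j) (y b) - pd ij (y b)).
Proof.
rewrite vfield_y vcoef_delta Coordinates.pd_y; case: (ij) b => i' j' [a b].
rewrite xpair_eqE; case: (j' =P b) => /= _; last first.
  by rewrite mul0r andbF subr0; apply: vanish_0.
rewrite andbT mul1r /xcoord eq_sym addrAC subrr add0r.
exact: vanish_y.
Qed.

Lemma vfield_delta_sqr b :
  vfield (delta_mx i j) (vfield (delta_mx i j) (y b)) =
  vfield (delta_mx i j) (y b) *+ (i == j).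
Proof.
rewrite vfield_y vcoef_delta; case: (j == b.2); last first.
  by rewrite mul0r raddf0 mul0rn.
by rewrite mul1r vfield_xcoord vcoef_delta eq_sym mulr_natl.
Qed.

Lemma vfield_delta_integral b f : integral_span y f ->
  integral_span y (vfield (delta_mx i j) (y b) * f).
Proof.
move=> Lf; rewrite vfield_y vcoef_delta; case: (j == b.2); last first.
  by rewrite !mul0r; apply: integral_span_0.
rewrite mul1r /xcoord mulrDl; apply: integral_span_D;
  last exact: integral_span_y.
by case: (_ == _); rewrite ?mul1r ?mul0r //; apply: integral_span_0.
Qed.
End InvariantVectorField.
End RightMultiplication.

(** * Independence of the ordered monomials *)

Section Independence.
Context (n : nat) (U : algType rat) (iota : {linear 'M[rat]_n -> U}).
Local Notation J := ('I_n * 'I_n)%type.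
Local Notation S := (Coordinates.S n).
Local Notation y := (@Coordinates.y n).
Context (F : {lrmorphism U -> lendo S}) (F_iota : F \o iota =1 @rmul_rep n).

(** The element of U named by the symbol [ysym]. *)
Definition ykost (ij : J) (k : nat) : U :=
  if (insub ij : option (Phi n)) is Some al then Xdiv iota al k
  else Hbin iota ij.1 k.

Lemma ykost_root (al : Phi n) k : ykost (val al) k = Xdiv iota al k.
Proof. by rewrite /ykost valK. Qed.

Lemma ykost_diag i k : ykost (i, i) k = Hbin iota i k.
Proof. by rewrite /ykost insubN //= eqxx. Qed.

Lemma ykost0 ij : ykost ij 0 = 1.
Proof.
elim/root_or_diag: ij => [al|i]; first by rewrite ykost_root; apply: dpow0.
by rewrite ykost_diag; apply: hbin0.
Qed.

Lemma ykostS ij k : ykost ij k.+1 *+ k.+1 =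
  iota (delta_mx ij.1 ij.2) * ykost ij k - ykost ij k *+ ((ij.1 == ij.2) * k).
Proof.
elim/root_or_diag: ij => [al|i].
  rewrite !ykost_root (negbTE (valP al)) mul0n mulr0n subr0.
  exact: (@dpowS _ (iota (delta_mx (src al) (tgt al))) k).
rewrite !ykost_diag eqxx mul1n.
have := @hbinS _ (iota (delta_mx i i)) k; rewrite mulrBr mulr_natr.
by rewrite hbin_comm.
Qed.

Lemma lendo_mulrn (u : lendo S) k f : (u *+ k) f = u f *+ k.
Proof. by elim: k => [|k IH] //; rewrite !mulrS -IH. Qed.

Definition yop ij k : {linear S -> S} := lendo_fun (F (ykost ij k)).

Definition invfield (ij : J) : {linear S -> S} := vfield (delta_mx ij.1 ij.2).

Lemma yop_div ij : divided_seq (invfield ij) (ij.1 == ij.2) (yop ij).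
Proof.
split=> [f|k f]; first by rewrite /yop ykost0 rmorph1.
rewrite /yop -lendo_mulrn -raddfMn /= ykostS raddfB raddfMn /= rmorphM /=.
rewrite -lendo_mulrn; have /= -> := F_iota (delta_mx ij.1 ij.2).
by [].
Qed.

Definition pd (ij : J) : {linear S -> S} := @Coordinates.pd n ij.
Definition pdop ij k : {linear S -> S} :=
  lendo_fun (dpow (Lendo (@Coordinates.pd_linear n ij)) k).

Lemma pdop_div ij : divided_seq (pd ij) 0 (pdop ij).
Proof.
split=> [f|k f]; first by rewrite /pdop dpow0.
by rewrite mul0n mulr0n subr0 /pdop -lendo_mulrn dpowS.
Qed.

Lemma compose_yop (a : J -> nat) e f :
  compose yop a e f = F (\prod_(j <- e) ykost j (a j)) f.
Proof.
elim: e => [|j e IH] /=; first by rewrite big_nil rmorph1.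
by rewrite big_cons rmorphM IH.
Qed.

Lemma kostant_integral u f : u \in kostant iota ->
  integral_span y f -> integral_span y (F u f).
Proof.
have int_ykost ij k g : integral_span y g -> integral_span y (F (ykost ij k) g).
  apply: (@integral_P _ _ y invfield _ yop).
  - by move=> i; apply: vfield_der.
  - exact: yop_div.
  - exact: vfield_delta_sqr.
  exact: vfield_delta_integral.
move=> /boolp.asboolP Ku;
  elim: Ku f => {u} [u|f|u v _ IHu _ IHv f Lf|u v _ IHu _ IHv f Lf].
- case=> [i|al] k f Lf; first by rewrite -ykost_diag; apply: int_ykost.
  by rewrite -ykost_root; apply: int_ykost.
- by rewrite rmorph1.
- by rewrite raddfB; apply: integral_span_B; [apply: IHu|apply: IHv].
by rewrite rmorphM; apply/IHu/IHv.
Qed.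

(** Apply z to the monomial w and evaluate at the identity matrix y = 0. The
value is an integer, and so equal to its numerator. *)
Definition coeff_form (w : seq J) (z : UZ iota) : int :=
  numq (Coordinates.eps (F (\val z) (ymon y w))).

Lemma coeff_formE w z :
  (coeff_form w z)%:~R = Coordinates.eps (F (\val z) (ymon y w)).
Proof.
have [a eps_a] : exists a : int,
    Coordinates.eps (F (\val z) (ymon y w)) = a%:~R.
  apply: (@integral_eps _ _ y (@Coordinates.eps n));
    first exact: Coordinates.eps_y.
  apply: kostant_integral (integral_ymon y w); exact: valP.
by rewrite /coeff_form eps_a numq_int.
Qed.

Lemma coeff_formD w z z' :
  coeff_form w (z + z') = coeff_form w z + coeff_form w z'.
Proof.
apply: (@intr_inj rat); rewrite intrD !coeff_formE raddfD /= raddfD /=.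
by rewrite -raddfD.
Qed.

Lemma coeff_form_mono w (a : J -> nat) z :
  \val z = \prod_(j <- enum {: J}) ykost j (a j) ->
  (\sum_(j <- enum {: J}) a j <= size w)%N ->
  coeff_form w z = ([forall j, a j == count_mem j w] : nat).
Proof.
move=> zE le_a; apply: (@intr_inj rat); rewrite coeff_formE zE -compose_yop.
rewrite (@eps_compose_P _ _ y invfield pd (fun ij =>
  ij.1 == ij.2) yop pdop (@Coordinates.eps n)) //.
- congr (nat_of_bool _)%:R; apply/allP/forallP => [H j|H j _]; last exact: H.
  by apply: H; rewrite mem_enum.
- exact: Coordinates.eps_y.
- by move=> j; apply: vfield_der.
- by move=> j; apply: Coordinates.pd_der.
- exact: yop_div.
- exact: pdop_div.
- exact: Coordinates.pd_y.
- exact: vfield_delta_vanish.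
- exact: vfield_delta_sqr.
- exact: enum_uniq.
by move=> j _; rewrite mem_enum.
Qed.

Lemma exists_count (T : eqType) (a : T -> nat) (e : seq T) : uniq e ->
  exists w, size w = (\sum_(j <- e) a j)%N /\
    forall j, count_mem j w = (if j \in e then a j else 0)%N.
Proof.
elim: e => [|i e IH] /=; first by exists [::]; rewrite big_nil.
move=> /andP[i_e /IH[w [size_w count_w]]]; exists (nseq (a i) i ++ w).
rewrite size_cat size_nseq big_cons size_w; split=> // j.
rewrite count_cat count_w count_nseq inE eq_sym /=.
by have [<-|_] := eqVneq i j; rewrite ?(negbTE i_e) ?mul1n ?addn0.
Qed.

Context (K : fieldType) (D : algType K) (theta : {rmorphism UZ iota -> D}).
Context (q : nat).
Hypothesis tensD : is_base_change theta.

(** Pair a vanishing combination with the monomial in y whose exponent a0 is of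
maximal degree among those with a nonzero coefficient: every other term of the
combination pairs to 0. *)
Lemma ykost_free (c : {ffun J -> 'I_q} -> K) (z : {ffun J -> 'I_q} -> UZ iota) :
  (forall a, \val (z a) = \prod_(j <- enum {: J}) ykost j (a j)) ->
  \sum_a c a *: theta (z a) = 0 -> forall a, c a = 0.
Proof.
move=> zE sum0 a1; apply/eqP/contraT => c_a1.
pose deg (a : {ffun J -> 'I_q}) : nat := (\sum_(j <- enum {: J}) a j)%N.
have [a0 c_a0 max_a0] := @arg_maxnP _ a1 (fun a => c a != 0) deg c_a1.
have [w [size_w count_w]] := @exists_count _ (fun j =>
  a0 j) (enum {: J}) (enum_uniq _).
have [|g [gE _]] := tensD (f := fun (b : K) r => b * (coeff_form w r)%:~R).
  by split=> [b b' r|b r r']; rewrite ?mulrDl // coeff_formD intrD mulrDr.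
suff : c a0 = 0 by move=> /eqP; rewrite (negbTE c_a0).
have := congr1 g sum0; rewrite raddf0 raddf_sum => <-.
have lambda a : c a != 0 -> coeff_form w (z a) = ((a == a0) : nat).
  move=> c_a; rewrite (coeff_form_mono (zE a)) ?size_w; last exact: max_a0.
  congr (Posz (nat_of_bool _)); apply/forallP/eqP => [a_w|-> j].
    by apply/ffunP => j; apply/val_inj/eqP; have := a_w j;
      rewrite count_w mem_enum.
  by rewrite count_w mem_enum.
rewrite (bigD1 a0) //= [X in _ + X]big1 => [|a ne_a].
  by rewrite gE (lambda _ c_a0) eqxx mulr1 addr0.
rewrite gE; have [->|c_a] := eqVneq (c a) 0; first by rewrite mul0r.
by rewrite (lambda _ c_a) (negbTE ne_a) mulr0.
Qed.
End Independence.

(** * The presentation *)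

Lemma span_mod_fin (K : fieldType) (A : lalgType K) (R : A -> Prop)
    (T : finType) (b : T -> A) f : span_mod R (fun g => exists t, g = b t) f ->
  exists c : T -> K, ideal_gen R (f - \sum_t c t *: b t).
Proof.
elim=> {f} [f If|_ [t ->]|f g _ [c Ic] _ [c' Ic']|k f _ [c Ic]].
- by exists (fun=> 0); rewrite big1 ?subr0 // => t _; rewrite scale0r.
- exists (fun t' => (t' == t)%:R).
  rewrite (bigD1 t) //= eqxx scale1r big1 ?addr0 ?subrr;
    first exact: ideal_gen_0.
  by move=> i /negbTE->; rewrite scale0r.
- exists (fun t => c t + c' t).
  under eq_bigr do rewrite scalerDl.
  by rewrite big_split opprD addrACA; apply: ideal_gen_D.
exists (fun t => k * c t).
under eq_bigr do rewrite -scalerA.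
by rewrite -scaler_sumr -scalerBr; apply: ideal_genZ.
Qed.

Theorem lemma5p1 (K : closedFieldType) (p m n : nat)
    (charK : p \in [pchar K]) (m_gt0 : (0 < m)%N)
    (U : algType rat) (iota : {linear 'M[rat]_n -> U})
    (envU : is_enveloping iota)
    (D : algType K) (theta : {rmorphism UZ iota -> D})
    (tensD : is_base_change theta) :
  (forall y : D, Dist theta (p ^ m) y <->
     exists f : freeAlg n (p ^ m) K, y = pres theta f) /\
  (forall f : freeAlg n (p ^ m) K,
     pres theta f = 0 <-> ideal_gen (@relator n K p m) f).
Proof.
have [iota_lie univ] := envU.
split=> [y|f]; first exact: Dist_pres.
split=> [pres_f|]; last exact: ideal_sound.
have [c If] := span_mod_fin (malg_span charK f).
have := ideal_sound theta iota_lie charK If.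
rewrite raddfB /= pres_f sub0r => /eqP; rewrite oppr_eq0 raddf_sum => /eqP sum0.
have lift (a : {ffun 'I_n * 'I_n -> 'I_(p ^ m)}) :
  lifts theta (qmono (@ysym n K p m) a)
    (\prod_(j <- enum {: 'I_n * 'I_n}) ykost iota j (a j)).
  rewrite /qmono /mono; elim: (enum _) => [|j e IH].
    by rewrite !big_nil; apply: lifts1.
  rewrite !big_cons; apply: liftsM IH; elim/root_or_diag: j => [al|i].
    by rewrite ysym_root ykost_root; apply: lifts_x.
  by rewrite ysym_diag ykost_diag; apply: lifts_h.
have [F [F_iota _]] := univ _ (@rmul_rep n) (@rmul_rep_lie n).
pose z a := s2val (boolp.cid2 (lift a)).
have zP a : pres theta (qmono (@ysym n K p m) a) = theta (z a) :=
  s2valP (boolp.cid2 (lift a)).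
have zE a := s2valP' (boolp.cid2 (lift a)).
have c0 := ykost_free F_iota tensD zE.
move: If; rewrite big1 ?subr0 // => a _; rewrite (c0 c) ?scale0r //.
rewrite -[RHS]sum0; apply: eq_bigr => b _; by rewrite -zP -presZ.
Qed.
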